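(* Let $\mathbb{K}$ be a field. Let $\mathcal{B}\subset \mathbb{Z}_{\geq 1}^4$ be the set of primitive vectors $\mathbf{w}=(w_1,w_2,w_3,w_4)\in\mathbb{Z}_{\geq 1}^4$ such that, for the polynomial ring $S=\mathbb{K}[x_1,x_2,x_3,x_4]$ graded by $\deg(x_i)=w_i$, it is not the case that $S^{(e)}$ is nonstandard Koszul for all sufficiently large $e$ (equivalently, $S^{(e)}$ fails to be nonstandard Koszul for infinitely many integers $e\geq 1$). Then $$\liminf_{N\to\infty}\frac{\#\left(\mathcal{B}\cap[1,N]^4\right)}{N^4}\;\geq\;\frac{3}{40\pi^2}.$$
   Context: A vector $\mathbf{w}\in\mathbb{Z}_{\geq1}^4$ is primitive if $\gcd(w_1,w_2,w_3,w_4)=1$. For a positively $\mathbb{Z}$-graded $\mathbb{K}$-algebra $A=\bigoplus_{d\geq 0}A_d$ and an integer $e\geq 1$, the $e$-th Veronese subring is $A^{(e)}=\bigoplus_{k\geq 0}A_{ek}$. A standard $\mathbb{Z}$-graded $\mathbb{K}$-algebra $B$ (that is, $B_0=\mathbb{K}$ and $B$ is generated over $\mathbb{K}$ by a finite-dimensional $B_1$) is Koszul if the minimal graded $B$-free resolution of the residue field $\mathbb{K}=B/B_+$ is linear, i.e. $\operatorname{Tor}^B_i(\mathbb{K},\mathbb{K})_j=0$ whenever $i\neq j$. Let $A$ be a finitely generated positively $\mathbb{Z}$-graded $\mathbb{K}$-algebra with $A_0=\mathbb{K}$ and $\mathfrak{m}=A_+$ its homogeneous maximal ideal. $A$ is nonstandard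 Koszul if the associated graded ring $\operatorname{gr}_{\mathfrak{m}}(A)=\bigoplus_{k\geq 0}\mathfrak{m}^k/\mathfrak{m}^{k+1}$ is Koszul as a standard $\mathbb{Z}$-graded $\mathbb{K}$-algebra (graded by $k$). *)

(* Defs.v *)
From HB Require Import structures.
From mathcomp Require Import all_boot all_order all_algebra.
From mathcomp Require Import generic_quotient ring_quotient.
From mathcomp Require mpoly.
From mathcomp Require Import boolp.

Set Implicit Arguments.
Unset Strict Implicit.
Unset Printing Implicit Defensive.

Import GRing.Theory.
Local Open Scope ring_scope.

(* Finite sums of elements of G.  Every G below is stable under opposite, so
   this is the additive subgroup generated by G. *)
Inductive sums_of (V : zmodType) (G : V -> Prop) : V -> Prop :=
| sums_of0 : sums_of G 0
| sums_ofD x y : G x -> sums_of G y -> sums_of G (x + y).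

Section SumsOf.
Variable V : zmodType.
Implicit Types (G H : V -> Prop) (x y : V).

Lemma sums_of1 G x : G x -> sums_of G x.
Proof. by move=> Gx; rewrite -[x]addr0; apply: sums_ofD => //; apply: sums_of0. Qed.

Lemma sums_of_add G x y : sums_of G x -> sums_of G y -> sums_of G (x + y).
Proof.
move=> + Gy; elim=> [|z t Gz _ IH]; first by rewrite add0r.
by rewrite -addrA; apply: sums_ofD.
Qed.

Lemma sums_of_opp G x :
  (forall y, G y -> G (- y)) -> sums_of G x -> sums_of G (- x).
Proof.
move=> GN; elim=> [|z t Gz _ IH]; first by rewrite oppr0; apply: sums_of0.
by rewrite opprD; apply: sums_ofD => //; apply: GN.
Qed.

Lemma sums_of_sub G x y : (forall y, G y -> G (- y)) ->
  sums_of G x -> sums_of G y -> sums_of G (x - y).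
Proof. by move=> GN Gx Gy; apply: sums_of_add => //; apply: sums_of_opp. Qed.

Lemma sums_of_sum G n (f : 'I_n -> V) :
  (forall i, sums_of G (f i)) -> sums_of G (\sum_i f i).
Proof.
by move=> Gf; elim/big_rec: _ => [|i x _ Gx];
  [apply: sums_of0 | apply: sums_of_add].
Qed.

End SumsOf.

Lemma sums_of_mul (R : comNzRingType) (G H L : R -> Prop) x y :
  (forall a b, G a -> H b -> L (a * b)) ->
  sums_of G x -> sums_of H y -> sums_of L (x * y).
Proof.
move=> GHL + Hy; elim=> [|a b Ga _ IH]; first by rewrite mul0r; apply: sums_of0.
rewrite mulrDl; apply: sums_of_add => //.
elim: Hy => [|c d Hc _ IH']; first by rewrite mulr0; apply: sums_of0.
by rewrite mulrDr; apply: sums_ofD => //; apply: GHL.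
Qed.

(* A commutative algebra over K, given by its structure morphism, together with
   an internal grading by the natural numbers.  K-stability of the components
   follows from gmap_hcomp and hcompM. *)
Record gradedAlg (K : fieldType) := GradedAlg {
  gring :> comNzRingType;
  gmap : {rmorphism K -> gring};
  hcomp : nat -> gring -> Prop;
  hcomp0 : forall d, hcomp d 0;
  hcompB : forall d x y, hcomp d x -> hcomp d y -> hcomp d (x - y);
  gmap_hcomp : forall c, hcomp 0 (gmap c);
  hcompM : forall i j x y, hcomp i x -> hcomp j y -> hcomp (i + j) (x * y);
  hcomp_gen : forall x, sums_of (fun y => exists d, hcomp d y) x;
  hcomp_free : forall n (f : nat -> gring), (forall d, hcomp d (f d)) ->
    \sum_(d < n) f d = 0 -> forall d, (d < n)%N -> f d = 0
}.

Section GradedTheory.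
Variables (K : fieldType) (A : gradedAlg K).
Implicit Types (x y : A) (d i j : nat) (P : nat -> Prop).

Lemma hcompN d x : hcomp d x -> hcomp d (- x).
Proof. by move=> hx; rewrite -[- x]add0r; apply: hcompB => //; apply: hcomp0. Qed.

Lemma hcompD d x y : hcomp d x -> hcomp d y -> hcomp d (x + y).
Proof. by move=> hx hy; rewrite -[y]opprK; apply: hcompB => //; apply: hcompN. Qed.

Lemma hcomp1 : hcomp 0 (1 : A).
Proof. by rewrite -(rmorph1 (gmap A)); apply: gmap_hcomp. Qed.

Definition hsums P x := sums_of (fun y => exists2 d, P d & hcomp d y) x.

Lemma hsums_opp_gen P y :
  (exists2 d, P d & hcomp d y) -> exists2 d, P d & hcomp d (- y).
Proof. by case=> d Pd hy; exists d => //; apply: hcompN. Qed.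

Lemma hsumsP P x : hsums P x -> exists n (f : nat -> A),
  [/\ forall d, hcomp d (f d), forall d, ~ P d -> f d = 0 & x = \sum_(d < n) f d].
Proof.
elim=> [|a b [k Pk ha] _ [n [f [hf f0 ->]]]].
  exists 0%N, (fun=> 0); split=> // [d|]; first exact: hcomp0.
  by rewrite big_ord0.
pose f' d := if (d < n)%N then f d else 0.
exists (maxn n k.+1), (fun d => f' d + (if d == k then a else 0)).
have hf' d : hcomp d (f' d) by rewrite /f'; case: ifP => _ //; apply: hcomp0.
split=> [d|d Pd|].
- by apply: hcompD => //; case: eqP => [->|_] //; apply: hcomp0.
- have -> : f' d = 0 by rewrite /f'; case: ifP => // _; exact: f0.
  by rewrite add0r; case: eqP => // dk; case: Pd; rewrite dk.
- rewrite big_split /= addrC; congr (_ + _); last first.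
    rewrite (big_ord_widen _ f (leq_maxl n k.+1)) big_mkcond /=.
    by apply: eq_bigr.
  have km : (k < maxn n k.+1)%N by rewrite leq_max ltnSn orbT.
  rewrite (bigD1 (Ordinal km)) //= eqxx big1 ?addr0 // => i ik.
  by rewrite (negPf (_ : (i : nat) != k)).
Qed.

Definition irrelevant x := hsums (fun d => (0 < d)%N) x.

Lemma irrelevantN1 : ~ irrelevant 1.
Proof.
case/hsumsP=> n [f [hf f0 e1]].
have f00 : f 0%N = 0 by apply: f0.
case: n e1 => [|n] e1.
  by move/eqP: e1; rewrite big_ord0 oner_eq0.
pose g d := if d == 0%N then 1 else - f d.
have hg d : hcomp d (g d).
  by rewrite /g; case: eqP => [->|_]; [apply: hcomp1 | apply: hcompN].
have sg : \sum_(d < n.+1) g d = 0.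
  move: e1; rewrite !big_ord_recl /= f00 add0r /g /= => e1.
  by rewrite sumrN -e1 subrr.
by have /eqP := hcomp_free hg sg (ltn0Sn n); rewrite oner_eq0.
Qed.

Lemma irrelevantM x y : irrelevant x -> irrelevant (x * y).
Proof.
move=> hx; apply: (sums_of_mul _ hx (hcomp_gen y)).
move=> a b [i i0 ha] [j hb]; exists (i + j)%N; last exact: hcompM.
by rewrite addn_gt0 i0.
Qed.

End GradedTheory.

(* S = K[x_1..x_n] with deg x_i = w_i *)
Section WeightedPolynomials.
Import mpoly.

Definition wdeg n (w : 'I_n -> nat) (m : 'X_{1..n}) : nat :=
  (\sum_(i < n) w i * m i)%N.

Lemma wdeg0 n (w : 'I_n -> nat) : wdeg w 0%MM = 0%N.
Proof. by rewrite /wdeg big1 // => i _; rewrite mnm0E muln0. Qed.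

Lemma wdegD n (w : 'I_n -> nat) : {morph wdeg w : m1 m2 / (m1 + m2)%MM >-> (m1 + m2)%N}.
Proof.
by move=> m1 m2; rewrite /wdeg -big_split /=; apply: eq_bigr => i _;
  rewrite mnmDE mulnDr.
Qed.

HB.instance Definition _ n (w : 'I_n -> nat) :=
  isMeasure.Build n (wdeg w) (wdeg0 w) (wdegD w).

Variables (K : fieldType) (n : nat) (w : 'I_n -> nat).

Definition wcomp d (p : {mpoly K[n]}) : Prop := p \is d.-homog for (wdeg w).

Lemma wcomp0 d : wcomp d 0. Proof. exact: dhomog0. Qed.

Lemma wcompB d p q : wcomp d p -> wcomp d q -> wcomp d (p - q).
Proof. by rewrite /wcomp => hp hq; rewrite rpredB. Qed.

Lemma wcompC (c : K) : wcomp 0 c%:MP.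
Proof. by rewrite /wcomp -[c%:MP]mulr1 mul_mpolyC rpredZ // dhomog1. Qed.

Lemma wcompM i j p q : wcomp i p -> wcomp j q -> wcomp (i + j) (p * q).
Proof. exact: dhomogM. Qed.

Lemma wcomp_gen p : sums_of (fun q => exists d, wcomp d q) p.
Proof.
rewrite (mpolyE p); elim/big_rec: _ => [|m q _ hq]; first exact: sums_of0.
apply: sums_ofD => //; exists (wdeg w m).
by rewrite /wcomp rpredZ // dhomogX.
Qed.

Lemma wcomp_free k (f : nat -> {mpoly K[n]}) : (forall d, wcomp d (f d)) ->
  \sum_(d < k) f d = 0 -> forall d, (d < k)%N -> f d = 0.
Proof.
move=> hf s0 d dk; apply/mpolyP => m; rewrite mcoeff0.
have [e|ne] := eqVneq (wdeg w m) d; last exact: (dhomog_nemf_coeff (hf d)).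
have := congr1 (mcoeff m) s0.
rewrite raddf_sum mcoeff0 /= (bigD1 (Ordinal dk)) //= big1 ?addr0 // => i ik.
by apply: (dhomog_nemf_coeff (hf i)); rewrite /= e eq_sym.
Qed.

Definition wpoly : gradedAlg K :=
  @GradedAlg K {mpoly K[n]} (@mpolyC n K) wcomp wcomp0 wcompB wcompC wcompM
    wcomp_gen wcomp_free.

End WeightedPolynomials.

Section Veronese.
Variables (K : fieldType) (A : gradedAlg K) (e : nat).

Definition veronese_pred : {pred A} :=
  fun x => `[< hsums (fun d => (e %| d)%N) x >].

Lemma veronese_subring : subring_closed veronese_pred.
Proof.
split=> [|x y /asboolP hx /asboolP hy|x y /asboolP hx /asboolP hy]; apply/asboolP.
- by apply: sums_of1; exists 0%N; [exact: dvdn0 | exact: hcomp1].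
- by apply: sums_of_sub => // z; apply: hsums_opp_gen.
- apply: (sums_of_mul _ hx hy) => a b [i ei ha] [j ej hb].
  by exists (i + j)%N; [rewrite dvdn_addr | apply: hcompM].
Qed.

HB.instance Definition _ :=
  GRing.isSubringClosed.Build A veronese_pred veronese_subring.

Record veronese_ring :=
  VeroneseRing { veronese_val :> A; _ : veronese_val \in veronese_pred }.

HB.instance Definition _ := [isSub for veronese_val].
HB.instance Definition _ := [Choice of veronese_ring by <:].
HB.instance Definition _ := [SubChoice_isSubComNzRing of veronese_ring by <:].

Lemma veronese_map_subproof c : gmap A c \in veronese_pred.
Proof.
by apply/asboolP/sums_of1; exists 0%N; [exact: dvdn0 | exact: gmap_hcomp].
Qed.

Definition veronese_map (c : K) : veronese_ring :=
  VeroneseRing (veronese_map_subproof c).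

Lemma veronese_map_zmod : zmod_morphism veronese_map.
Proof. by move=> x y; apply: val_inj; exact: (rmorphB (gmap A)). Qed.

Lemma veronese_map_monoid : monoid_morphism veronese_map.
Proof.
split; first by apply: val_inj; exact: (rmorph1 (gmap A)).
by move=> x y; apply: val_inj; exact: (rmorphM (gmap A)).
Qed.

HB.instance Definition _ :=
  GRing.isZmodMorphism.Build K veronese_ring veronese_map veronese_map_zmod.
HB.instance Definition _ :=
  GRing.isMonoidMorphism.Build K veronese_ring veronese_map veronese_map_monoid.

Definition vcomp k (x : veronese_ring) : Prop := hcomp (e * k)%N (val x).

Lemma vcomp0 d : vcomp d 0. Proof. exact: hcomp0. Qed.

Lemma vcompB d x y : vcomp d x -> vcomp d y -> vcomp d (x - y).
Proof. exact: hcompB. Qed.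

Lemma vcompC c : vcomp 0 (veronese_map c).
Proof. by rewrite /vcomp muln0; apply: gmap_hcomp. Qed.

Lemma vcompM i j x y : vcomp i x -> vcomp j y -> vcomp (i + j) (x * y).
Proof. by rewrite /vcomp mulnDr; apply: hcompM. Qed.

Lemma vcomp_gen x : sums_of (fun y => exists d, vcomp d y) x.
Proof.
have [a hx] : exists a, a = val x by exists (val x).
have : hsums (fun d => (e %| d)%N) a by rewrite hx; case: x {hx} => x /= /asboolP.
move=> ha; elim: ha x hx => [|b c [d ed hb] hc IH] x hx.
  by have -> : x = 0 by [apply: val_inj]; apply: sums_of0.
have bV : b \in veronese_pred by apply/asboolP/sums_of1; exists d.
have cV : c \in veronese_pred by apply/asboolP.
have -> : x = VeroneseRing bV + VeroneseRing cV by apply: val_inj.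
apply: sums_ofD; last exact: IH.
by exists (d %/ e)%N; rewrite /vcomp mulnC divnK.
Qed.

Lemma vcomp_free : (0 < e)%N ->
  forall n (f : nat -> veronese_ring), (forall d, vcomp d (f d)) ->
  \sum_(d < n) f d = 0 -> forall d, (d < n)%N -> f d = 0.
Proof.
move=> e0 n f hf s0 d dn; apply: val_inj => /=.
pose g j := if (e %| j)%N then val (f (j %/ e)%N) else 0.
have hg j : hcomp j (g j).
  rewrite /g; case: ifP => ej; last exact: hcomp0.
  by have := hf (j %/ e)%N; rewrite /vcomp mulnC divnK.
have sg m : \sum_(j < m * e) g j = \sum_(k < m) val (f k).
  elim: m => [|m IH]; first by rewrite mul0n !big_ord0.
  rewrite big_ord_recr /= -IH mulSn addnC big_split_ord /=; congr (_ + _).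
  rewrite (bigD1 (Ordinal e0)) //= addn0 /g dvdn_mull // mulnK // big1 ?addr0 //.
  move=> i i0; rewrite dvdn_addr ?dvdn_mull // ifN //; apply/negP => ei.
  move: i0; rewrite -val_eqE /= -lt0n => i0.
  by have := dvdn_leq i0 ei; rewrite leqNgt ltn_ord.
have sg0 : \sum_(j < n * e) g j = 0.
  have vD : {morph veronese_val : x y / x + y} by [].
  have v0 : veronese_val 0 = 0 by [].
  by rewrite sg -(big_morph _ vD v0) s0.
have := hcomp_free hg sg0 (d := (d * e)%N).
by rewrite ltn_mul2r e0 dn => /(_ isT); rewrite /g dvdn_mull // mulnK.
Qed.

(* For e = 0 the subring is A_0, on which vcomp is not a direct grading. *)
Definition veronese (e_gt0 : (0 < e)%N) : gradedAlg K :=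
  @GradedAlg K veronese_ring veronese_map vcomp vcomp0 vcompB vcompC vcompM
    vcomp_gen (vcomp_free e_gt0).

End Veronese.

(* For m = A_+, the ring gr_m(A) = \bigoplus_k m^k / m^(k+1) is obtained as the
   quotient of \bigoplus_k m^k (the Rees algebra, realized as the polynomials p
   over A with p`_k \in m^k) by the ideal \bigoplus_k m^(k+1) (those with
   p`_k \in m^(k+1)). *)
Section AssociatedGraded.
Variables (K : fieldType) (A : gradedAlg K).

Fixpoint mpow k : A -> Prop :=
  if k is j.+1 then
    sums_of (fun x => exists a b, [/\ irrelevant a, mpow j b & x = a * b])
  else fun=> True.

Lemma mpow_opp_gen k (y : A) :
  (exists a b, [/\ irrelevant a, mpow k b & y = a * b]) ->
  exists a b, [/\ irrelevant a, mpow k b & - y = a * b].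
Proof.
case=> a [b [ha hb ->]]; exists (- a), b; split=> //; last by rewrite mulNr.
by apply: sums_of_opp ha => z; apply: hsums_opp_gen.
Qed.

Lemma mpow0 k : mpow k 0. Proof. by case: k => //= k; apply: sums_of0. Qed.

Lemma mpowB k x y : mpow k x -> mpow k y -> mpow k (x - y).
Proof.
case: k => //= k; apply: sums_of_sub => z; exact: mpow_opp_gen.
Qed.

Lemma mpowD k x y : mpow k x -> mpow k y -> mpow k (x + y).
Proof. by case: k => //= k; apply: sums_of_add. Qed.

Lemma mpowM i j x y : mpow i x -> mpow j y -> mpow (i + j) (x * y).
Proof.
elim: i x => [|i IH] x /=.
  move=> _; elim: j y => [//|j IH] y /= hy; rewrite mulrC.
  elim: hy => [|c d [a [b [ha hb ->]]] _ IH']; first by rewrite mul0r; apply: sums_of0.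
  rewrite mulrDl; apply: sums_ofD => //; exists a, (x * b); split=> //.
    exact: IH.
  by rewrite mulrAC mulrA mulrAC.
move=> hx hy; elim: hx => [|c d [a [b [ha hb ->]]] _ IH']; first by rewrite mul0r; apply: sums_of0.
rewrite mulrDl; apply: sums_ofD => //; exists a, (b * y); split=> //.
  exact: IH.
by rewrite mulrA.
Qed.

Lemma mpow1N1 : ~ mpow 1 1.
Proof.
move=> h; apply: (@irrelevantN1 _ A); move: h => /=.
elim=> [|c d [a [b [ha _ ->]]] _ IH]; first exact: sums_of0.
by apply: sums_of_add IH; apply: irrelevantM.
Qed.

Definition rees_pred : {pred {poly A}} := fun p => `[< forall k, mpow k p`_k >].

Lemma rees_subring : subring_closed rees_pred.
Proof.
split=> [|p q /asboolP hp /asboolP hq|p q /asboolP hp /asboolP hq]; apply/asboolP => k.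
- by rewrite coef1; case: k => [//|k]; apply: mpow0.
- by rewrite coefB; apply: mpowB.
- rewrite coefM; elim/big_rec: _ => [|i x _ hx]; first exact: mpow0.
  have ik : (i <= k)%N by rewrite -ltnS.
  by apply: mpowD => //; have := mpowM (hp i) (hq (k - i)%N); rewrite subnKC.
Qed.

HB.instance Definition _ :=
  GRing.isSubringClosed.Build {poly A} rees_pred rees_subring.

Record rees := Rees { rees_val :> {poly A}; _ : rees_val \in rees_pred }.

HB.instance Definition _ := [isSub for rees_val].
HB.instance Definition _ := [Choice of rees by <:].
HB.instance Definition _ := [SubChoice_isSubComNzRing of rees by <:].

Lemma reesP (p : rees) k : mpow k (val p)`_k.
Proof. by case: p => p /= /asboolP. Qed.

Definition gr_ideal : {pred rees} := fun p => `[< forall k, mpow k.+1 (val p)`_k >].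

Lemma gr_ideal_closed : idealr_closed gr_ideal.
Proof.
split=> [||u p q /asboolP hp /asboolP hq].
- by apply/asboolP => k; rewrite coef0; apply: mpow0.
- by apply/negP => /asboolP /(_ 0%N); rewrite coef1; apply: mpow1N1.
- apply/asboolP => k; rewrite coefD; apply: mpowD => //.
  rewrite coefM; elim/big_rec: _ => [|i x _ hx]; first exact: mpow0.
  have ik : (i <= k)%N by rewrite -ltnS.
  apply: mpowD => //.
  by have := mpowM (reesP u i) (hp (k - i)%N); rewrite addnS subnKC.
Qed.

HB.instance Definition _ := isIdealr.Build rees gr_ideal gr_ideal_closed.

Definition gr_ring : comNzRingType := {ideal_quot gr_ideal}.

Definition gr_pi (p : rees) : gr_ring := \pi_{ideal_quot gr_ideal}%qT p.

Lemma gr_piB : {morph gr_pi : p q / p - q}.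
Proof. exact: (rmorphB (\pi_{ideal_quot gr_ideal}%qT)). Qed.

Lemma gr_piD : {morph gr_pi : p q / p + q}.
Proof. exact: (rmorphD (\pi_{ideal_quot gr_ideal}%qT)). Qed.

Lemma gr_piM : {morph gr_pi : p q / p * q}.
Proof. exact: (rmorphM (\pi_{ideal_quot gr_ideal}%qT)). Qed.

Lemma gr_pi0 : gr_pi 0 = 0.
Proof. exact: (rmorph0 (\pi_{ideal_quot gr_ideal}%qT)). Qed.

Lemma gr_pi1 : gr_pi 1 = 1.
Proof. exact: (rmorph1 (\pi_{ideal_quot gr_ideal}%qT)). Qed.

Lemma gr_pi_eq0 p : gr_pi p = 0 <-> forall k, mpow k.+1 (val p)`_k.
Proof.
have -> : (gr_pi p = 0) <-> (p \in gr_ideal).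
  rewrite -gr_pi0 -[p in p \in _]subr0 Quotient.idealrBE.
  by split=> [h|/eqP //]; apply/eqP.
by split=> [/asboolP|h] //; apply/asboolP.
Qed.

Lemma gr_pi_surj z : exists p, z = gr_pi p.
Proof. by exists (repr z); rewrite /gr_pi reprK. Qed.

Lemma gr_map_subproof c : (gmap A c)%:P \in rees_pred.
Proof.
by apply/asboolP => k; rewrite coefC; case: k => [//|k]; apply: mpow0.
Qed.

Definition gr_map (c : K) : gr_ring := gr_pi (Rees (gr_map_subproof c)).

Lemma gr_map_zmod : zmod_morphism gr_map.
Proof.
move=> x y; rewrite /gr_map -gr_piB; congr gr_pi; apply: val_inj => /=.
by rewrite rmorphB polyCB.
Qed.

Lemma gr_map_monoid : monoid_morphism gr_map.
Proof.
split=> [|x y].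
  by rewrite /gr_map -gr_pi1; congr gr_pi; apply: val_inj; rewrite /= rmorph1.
rewrite /gr_map -gr_piM; congr gr_pi; apply: val_inj => /=.
by rewrite rmorphM polyCM.
Qed.

HB.instance Definition _ :=
  GRing.isZmodMorphism.Build K gr_ring gr_map gr_map_zmod.
HB.instance Definition _ :=
  GRing.isMonoidMorphism.Build K gr_ring gr_map gr_map_monoid.

(* m^k / m^(k+1); membership of a in m^k is part of p : rees *)
Definition grcomp k (z : gr_ring) : Prop :=
  exists p : rees, (exists a, val p = a *: 'X^k) /\ z = gr_pi p.

Lemma grcomp0 d : grcomp d 0.
Proof.
by exists 0; split; [exists 0; rewrite scale0r | rewrite gr_pi0].
Qed.

Lemma grcompB d x y : grcomp d x -> grcomp d y -> grcomp d (x - y).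
Proof.
move=> [p [[a pa] ->]] [q [[b qb] ->]]; exists (p - q); rewrite gr_piB; split=> //.
by exists (a - b); rewrite scalerBl -pa -qb.
Qed.

Lemma grcompC c : grcomp 0 (gr_map c).
Proof.
by exists (Rees (gr_map_subproof c)); split=> //; exists (gmap A c);
  rewrite alg_polyC.
Qed.

Lemma grcompM i j x y : grcomp i x -> grcomp j y -> grcomp (i + j) (x * y).
Proof.
move=> [p [[a pa] ->]] [q [[b qb] ->]]; exists (p * q); rewrite gr_piM; split=> //.
exists (a * b).
have -> : val (p * q) = val p * val q by [].
by rewrite pa qb -scalerAl -scalerAr scalerA -exprD.
Qed.

Lemma rees_mono_subproof (p : rees) k : (val p)`_k *: 'X^k \in rees_pred.
Proof.
apply/asboolP => j; rewrite coefZ coefXn; case: eqP => [->|_].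
  by rewrite mulr1; apply: reesP.
by rewrite mulr0; apply: mpow0.
Qed.

Lemma grcomp_gen x : sums_of (fun y => exists d, grcomp d y) x.
Proof.
have [p ->] := gr_pi_surj x.
have -> : p = \sum_(k < size (val p)) Rees (rees_mono_subproof p k).
  apply: val_inj.
  have vD : {morph rees_val : x y / x + y} by [].
  have v0 : rees_val 0 = 0 by [].
  by rewrite /= (big_morph _ vD v0) -poly_def coefK.
rewrite (big_morph _ gr_piD gr_pi0); apply: sums_of_sum => k.
apply: sums_of1; exists (k : nat), (Rees (rees_mono_subproof p k)).
by split=> //; exists (val p)`_k.
Qed.

Lemma grcomp_free n (f : nat -> gr_ring) : (forall d, grcomp d (f d)) ->
  \sum_(d < n) f d = 0 -> forall d, (d < n)%N -> f d = 0.
Proof.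
move=> hf s0 d dn.
have /choice [p hp] : forall d, exists p : rees,
    (exists a, val p = a *: 'X^d) /\ f d = gr_pi p by [].
have sp : gr_pi (\sum_(d < n) p d) = 0.
  rewrite (big_morph _ gr_piD gr_pi0); apply: etrans s0; apply: eq_bigr => i _.
  by case: (hp i).
have vD : {morph rees_val : x y / x + y} by [].
have v0 : rees_val 0 = 0 by [].
have [[a pa] ->] := hp d; apply/gr_pi_eq0 => k; rewrite pa coefZ coefXn.
case: eqP => [->|_]; last by rewrite mulr0; apply: mpow0.
move/gr_pi_eq0: sp => /(_ d); rewrite /= (big_morph _ vD v0) coef_sum.
rewrite (bigD1 (Ordinal dn)) //= big1 ?addr0 => [|i id].
  by have /= -> := pa; rewrite coefZ coefXn eqxx.
have [[b /= ->] _] := hp i.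
by rewrite coefZ coefXn (negPf (_ : d != i)) ?mulr0 // eq_sym.
Qed.

Definition assoc_graded : gradedAlg K :=
  @GradedAlg K gr_ring gr_map grcomp grcomp0 grcompB grcompC grcompM
    grcomp_gen grcomp_free.

End AssociatedGraded.

Section Koszul.
Variables (K : fieldType) (B : gradedAlg K).

Definition standard_graded : Prop :=
  [/\ forall x : B, hcomp 0 x -> exists c, x = gmap B c,
      exists n (g : 'I_n -> B), (forall i, hcomp 1 (g i)) /\
        forall x : B, hcomp 1 x ->
          exists c : 'I_n -> K, x = \sum_i gmap B (c i) * g i
    & forall P : B -> Prop,
        (forall c, P (gmap B c)) -> (forall x, hcomp 1 x -> P x) ->
        (forall x y, P x -> P y -> P (x + y)) ->
        (forall x y, P x -> P y -> P (x * y)) -> forall x, P x].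

(* The component of integer degree i - j. *)
Definition hcomp_sub (i j : nat) (x : B) : Prop :=
  if (j <= i)%N then hcomp (i - j)%N x else x = 0.

(* A graded free resolution of the residue field B / B_+,
     ... -> F_2 -> F_1 -> F_0 -> B / B_+ -> 0,
   with F_i = \bigoplus_t B(- fshift i t) of finite rank frank i, whose elements
   are row vectors over B.  The differential F_(i+1) -> F_i is
   v |-> v *m fdiff i; the augmentation sends v to the class of v *m faug
   modulo B_+.  All maps are homogeneous of degree 0. *)
Record graded_free_resolution := GradedFreeResolution {
  frank : nat -> nat;
  fshift : forall i, 'I_(frank i) -> nat;
  fdiff : forall i, 'M[B]_(frank i.+1, frank i);
  faug : 'cV[B]_(frank 0);
  fdiff_homog : forall i s t, hcomp_sub (fshift s) (fshift t) (fdiff i s t);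
  faug_homog : forall t, hcomp (fshift t) (faug t 0);
  faug_surj : exists v : 'rV[B]_(frank 0), irrelevant ((v *m faug) 0 0 - 1);
  fexact0 : forall v : 'rV[B]_(frank 0),
    irrelevant ((v *m faug) 0 0) <-> exists u, v = u *m fdiff 0;
  fexactS : forall i (v : 'rV[B]_(frank i.+1)),
    v *m fdiff i = 0 <-> exists u, v = u *m fdiff i.+1
}.

Definition minimal_resolution (F : graded_free_resolution) : Prop :=
  forall i s t, irrelevant (fdiff F i s t).

Definition linear_resolution (F : graded_free_resolution) : Prop :=
  forall i (t : 'I_(frank F i)), fshift t = i.

(* The minimal graded free resolution is unique up to isomorphism. *)
Definition koszul : Prop :=
  standard_graded /\
  exists F, minimal_resolution F /\ linear_resolution F.

End Koszul.

Definition nonstandard_koszul (K : fieldType) (A : gradedAlg K) : Prop :=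
  koszul (assoc_graded A).

Definition primitive (w : 'I_4 -> nat) : Prop :=
  \big[gcdn/0%N]_(i < 4) w i = 1%N.

Definition bad (K : fieldType) (w : 'I_4 -> nat) : Prop :=
  [/\ forall i, (0 < w i)%N, primitive w
    & ~ exists e0 : nat, forall (e : nat) (e_gt0 : (0 < e)%N), (e0 <= e)%N ->
          nonstandard_koszul (veronese (wpoly K w) e_gt0)].

(* Positivity being part of bad, this counts the bad vectors in [1,N]^4. *)
Definition bad_count (K : fieldType) (N : nat) : nat :=
  #|[set w : {ffun 'I_4 -> 'I_N.+1} | `[< bad K (fun i => w i) >]]|.

(* Main.v *)
(** If the monomials of degree e in S contain some g such that g^2 = h h' only for
    h = h' = g, while g^3 = h1 h2 h3 nontrivially, then gr S^(e) maps onto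
    K[T]/(T^3) by g -> T, and this cubic relation is not a consequence of
    quadratic ones, so S^(e) is not nonstandard Koszul.  Taking
    g = x1^G x2^W x3 x4 with G large, whether this happens depends only on the
    lattice {v in Z^3 | w2 v1 + w3 v2 + w4 v3 = 0 mod w1}: it must miss the box
    |v| <= (W,1,1) except for 0 and contain three vectors >= -(W,1,1) with sum 0.
    If w2 is a unit modulo n = w1, and (w3, w4) = w2 (u, v), this holds for (u/n, v/n)
    in an explicit region of area 1/40 of the torus.

    Multiplication by w2 permutes the residues modulo n, so letting (w3, w4)
    range over floor(N/n)^2 full periods counts exactly; the pairs (w1, w2)
    that are not coprime are removed by a union bound over the primes.  Both
    steps are lossy, but the area 1/40 leaves enough room: the resulting lower
    density exceeds 1/120 >= 3/(40 pi^2). *)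
Require Import Defs.
From mathcomp Require Import all_boot all_order all_algebra.
From mathcomp Require Import generic_quotient zify ring lra boolp.
From mathcomp Require mpoly.

Set Implicit Arguments.
Unset Strict Implicit.
Unset Printing Implicit Defensive.

Import Order.TTheory GRing.Theory Num.Theory.
Local Open Scope ring_scope.

(** * A cubic obstruction to Koszulness *)

Section KoszulObstruction.
Variables (K : fieldType) (B : gradedAlg K) (c : nat -> B -> K).
Hypothesis cD : forall k x y, c k (x + y) = c k x + c k y.
Hypothesis c1 : c 0 1 = 1.
Hypothesis cM : forall k x y, (k < 3)%N ->
  c k (x * y) = \sum_(i < k.+1) c i x * c (k - i)%N y.
Hypothesis c_hcomp : forall k d x, (k < 3)%N -> d != k -> hcomp d x -> c k x = 0.

Let c_0 k : c k 0 = 0.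
Proof. by apply: (addrI (c k 0)); rewrite -cD !addr0. Qed.

Let c_N k x : c k (- x) = - c k x.
Proof. by apply: (addrI (c k x)); rewrite -cD !subrr c_0. Qed.

Let c_mx k m n p (M : 'M[B]_(m, n)) (N : 'M[B]_(n, p)) : (k < 3)%N ->
  map_mx (c k) (M *m N) =
  \sum_(i < k.+1) map_mx (c i) M *m map_mx (c (k - i)%N) N.
Proof.
move=> k3; apply/matrixP => i j; rewrite mxE summxE mxE.
rewrite (big_morph _ (cD k) (c_0 k)).
under eq_bigr do rewrite cM //.
rewrite exchange_big /=; apply: eq_bigr => l _; rewrite mxE.
by apply: eq_bigr => s _; rewrite !mxE.
Qed.

Let c_scale k m n (x : B) (M : 'M[B]_(m, n)) : (k < 3)%N ->
  map_mx (c k) (x *: M) = \sum_(i < k.+1) c i x *: map_mx (c (k - i)%N) M.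
Proof.
move=> k3; apply/matrixP => i j; rewrite summxE !mxE cM //.
by apply: eq_bigr => l _; rewrite !mxE.
Qed.

Let c0_irrelevant x : irrelevant x -> c 0 x = 0.
Proof.
elim=> [|y z [d d0 hy] _ IH]; first exact: c_0.
by rewrite cD IH addr0 (@c_hcomp 0 d) // -lt0n.
Qed.

(* With c read as a graded ring map B -> K[T]/(T^3), the hypotheses say that
   g goes to T and p to 0.  If the linear syzygies generated all syzygies, the
   syzygy p q = g^2 g would exhibit, over K[T]/(T^3), the lift of g v0 to F_1 as
   a linear syzygy, although g v0 goes to T v0 <> 0. *)
Lemma not_koszul_cubic (g p q : B) :
  irrelevant g -> irrelevant q -> p * q = g * g * g -> c 1 g = 1 ->
  (forall k, (k < 3)%N -> c k p = 0) -> ~ koszul B.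
Proof.
move=> gI qI pqE cg cp [_ [F [_ Flin]]].
have cg0 : c 0 g = 0 by exact: c0_irrelevant.
have [v0 v0E] := faug_surj F.
have lift x : irrelevant x -> exists u, x *: v0 = u *m fdiff F 0.
  move=> xI; apply/fexact0; rewrite -scalemxAl mxE; exact: irrelevantM.
have [ug ugE] := lift g gI; have [uq uqE] := lift q qI.
have d10 : fdiff F 1 *m fdiff F 0 = 0.
  apply/row_matrixP => i; rewrite row_mul row0; apply/fexactS.
  by exists (delta_mx 0 i); rewrite rowE.
have /fexactS[z zE] : (p *: uq - (g * g) *: ug) *m fdiff F 0 = 0.
  by rewrite mulmxBl -!scalemxAl -ugE -uqE !scalerA pqE subrr.
(* Linearity of [F] makes every entry of a differential homogeneous of degree 1, so only its
   coefficient of T survives. *)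
have cdiff k i : (k < 3)%N -> k != 1%N -> map_mx (c k) (fdiff F i) = 0.
  move=> k3 k1; apply/matrixP => s t; rewrite !mxE.
  have := fdiff_homog s t; rewrite /hcomp_sub !Flin leqnSn subSnn.
  by apply: c_hcomp; rewrite // eq_sym.
have D10 : map_mx (c 1) (fdiff F 1) *m map_mx (c 1) (fdiff F 0) = 0.
  have := congr1 (map_mx (c 2)) d10; rewrite c_mx // !big_ord_recr big_ord0 /=.
  rewrite !(cdiff 0) // !(cdiff 2) // !(mulmx0, mul0mx, addr0, add0r) => ->.
  by apply/matrixP => i j; rewrite !mxE c_0.
have ug0 : - map_mx (c 0) ug = map_mx (c 1) z *m map_mx (c 1) (fdiff F 1).
  have := congr1 (map_mx (c 2)) zE; rewrite c_mx // !big_ord_recr big_ord0 /=.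
  rewrite !(cdiff 0) // !(cdiff 2) // !(mulmx0, addr0, add0r) => <-.
  have -> : map_mx (c 2) (p *: uq - (g * g) *: ug) =
            map_mx (c 2) (p *: uq) - map_mx (c 2) ((g * g) *: ug).
    by apply/matrixP => i j; rewrite !mxE cD c_N.
  rewrite !c_scale // big1 => [|i _]; last by rewrite cp ?scale0r.
  rewrite sub0r !big_ord_recr big_ord0 /= !cM // !big_ord_recr !big_ord0 /=.
  by rewrite cg cg0 !(mul0r, mulr0, add0r, addr0, scale0r, mulr1, scale1r).
have ugd : map_mx (c 0) ug *m map_mx (c 1) (fdiff F 0) = 0.
  by apply: oppr_inj; rewrite -mulNmx ug0 -mulmxA D10 mulmx0 oppr0.
(* Compare the coefficients of T in [g *: v0 = ug *m fdiff F 0]. The vanishing of [v0] modulo T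
   contradicts that its augmentation is 1 modulo the irrelevant ideal. *)
have v00 : map_mx (c 0) v0 = 0.
  have := congr1 (map_mx (c 1)) ugE; rewrite c_mx // c_scale //.
  rewrite !big_ord_recr !big_ord0 /= cg cg0 (cdiff 0) // ugd.
  by rewrite !(mulmx0, scale0r, add0r, addr0, scale1r).
have /c0_irrelevant := v0E; rewrite cD c_N c1.
have := congr1 (fun M : 'M[K]_1 => M 0 0) (@c_mx 0 _ _ _ v0 (faug F) isT).
rewrite big_ord_recr big_ord0 /= v00 mul0mx !(addr0, mxE) => ->.
by rewrite add0r => /eqP; rewrite oppr_eq0 oner_eq0.
Qed.

End KoszulObstruction.

(** * From monomials of degree e to the ring map from gr to K[T]/(T^3) *)

Section MonomialCriterion.
Import mpoly.
Variables (K : fieldType) (n : nat) (w : 'I_n -> nat) (g : 'X_{1..n}).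
Hypothesis w_gt0 : forall i, (0 < w i)%N.
Hypothesis e_gt0 : (0 < wdeg w g)%N.
Hypothesis g2_unique :
  forall m1 m2, wdeg w m1 = wdeg w g -> (m1 + m2 = g *+ 2)%MM -> m1 = g.

Let A := veronese (wpoly K w) e_gt0.
Let poly_of (x : A) : {mpoly K[n]} := val x.

Let poly_ofD x y : poly_of (x + y) = poly_of x + poly_of y.
Proof. by []. Qed.

Let poly_ofM x y : poly_of (x * y) = poly_of x * poly_of y.
Proof. by []. Qed.

Let supp k (p : {mpoly K[n]}) := forall m, p@_m != 0 ->
  (wdeg w g %| wdeg w m)%N /\ (wdeg w g * k <= wdeg w m)%N.

Let supported k (x : A) := supp k (poly_of x).

Let wdeg_eq0 m : wdeg w m = 0%N -> m = 0%MM.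
Proof.
move=> /eqP; rewrite sum_nat_eq0 => /forallP m0; apply/mnmP => i.
by have := m0 i; rewrite muln_eq0 eqn0Ngt w_gt0 mnm0E => /eqP.
Qed.

Let wdegMn m k : wdeg w (m *+ k)%MM = (wdeg w m * k)%N.
Proof.
rewrite /wdeg big_distrl /=; apply: eq_bigr => i _; by rewrite mulmnE mulnA.
Qed.

Let supported0 k : supported k 0.
Proof. by move=> m; rewrite /poly_of /= mcoeff0 eqxx. Qed.

Let suppD k p q : supp k p -> supp k q -> supp k (p + q).
Proof.
move=> hp hq m; rewrite mcoeffD => nz.
have [p0|/hp//] := eqVneq p@_m 0; apply: hq.
by move: nz; rewrite p0 add0r.
Qed.

Let suppM i j p q : supp i p -> supp j q -> supp (i + j) (p * q).
Proof.
move=> hp hq m; rewrite -mcoeff_msupp => /msuppM_le /allpairsP[[m1 m2] /=].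
rewrite !mcoeff_msupp => -[/hp[d1 l1] /hq[d2 l2] ->].
by rewrite wdegD dvdn_addr // mulnDr leq_add.
Qed.

Let supportedD k x y : supported k x -> supported k y -> supported k (x + y).
Proof. by rewrite /supported poly_ofD; apply: suppD. Qed.

Let supportedM i j x y : supported i x -> supported j y -> supported (i + j) (x * y).
Proof. by rewrite /supported poly_ofM; apply: suppM. Qed.

Let supported_vcomp k (x : A) : hcomp k x -> supported k x.
Proof.
move=> hx m nz; suff -> : wdeg w m = (wdeg w g * k)%N by rewrite dvdn_mulr.
by apply: contraNeq nz => ne; apply/eqP/(dhomog_nemf_coeff hx).
Qed.

Let supportedW k (x : A) : supported k x -> supported 0 x.
Proof. by move=> hx m /hx[? _]; rewrite muln0. Qed.

Let supported_any (x : A) : supported 0 x.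
Proof.
elim: (hcomp_gen x) => [|y z [d hy] _ IH]; first exact: supported0.
by apply: supportedD IH; apply: supportedW (supported_vcomp hy).
Qed.

Let supported_irrelevant (x : A) : irrelevant x -> supported 1 x.
Proof.
elim=> [|y z [d d0 hy] _ IH]; first exact: supported0.
apply: supportedD IH => m /(supported_vcomp hy)[? le]; split=> //.
by apply: leq_trans le; rewrite leq_mul2l d0 orbT.
Qed.

Let supported_mpow k (x : A) : mpow k x -> supported k x.
Proof.
elim: k x => [|k IH] x /=; first by move=> _; apply: supported_any.
elim=> [|y z [a [b [aI bk ->]]] _ IH']; first exact: supported0.
apply: supportedD IH'; rewrite -add1n; apply: supportedM (IH _ bk).
exact: supported_irrelevant.
Qed.

(** The future coefficient of T^k: it vanishes on [supported k.+1], hence on m^(k+1), so it descends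
    to gr. *)
Let gcoef k (x : A) : K := (poly_of x)@_(g *+ k)%MM.

Let gcoef_supported k (x : A) : supported k.+1 x -> gcoef k x = 0.
Proof.
move=> hx; apply/eqP; apply: contraT => /hx[_].
by rewrite wdegMn leq_pmul2l // ltnn.
Qed.

(** If i or j is 0, one factor has degree 0 and is the empty monomial because the weights are
    positive; the only case left, i = j = 1, is [g2_unique]. *)
Let split_power i j m1 m2 : (i + j < 3)%N -> wdeg w m1 = (wdeg w g * i)%N ->
  (m1 + m2 = g *+ (i + j))%MM -> m1 = (g *+ i)%MM.
Proof.
move=> ij3 wm1 mE.
have wm2 : wdeg w m2 = (wdeg w g * j)%N.
  have := congr1 (wdeg w) mE; rewrite wdegD wdegMn wm1 mulnDr.
  exact: addnI.
case: i => [|[|i]] in ij3 wm1 mE *.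
- by rewrite mulm0n; apply: wdeg_eq0; rewrite wm1 muln0.
- rewrite mulm1n; case: j => [|[|j]] // in ij3 wm2 mE *.
    have m20 : m2 = 0%MM by apply: wdeg_eq0; rewrite wm2 muln0.
    by move: mE; rewrite m20 addm0 addn0 mulm1n.
  by apply: g2_unique mE; rewrite wm1 muln1.
- have j0 : j = 0%N by lia.
  have m20 : m2 = 0%MM by apply: wdeg_eq0; rewrite wm2 j0 muln0.
  by move: mE; rewrite m20 j0 addm0 addn0.
Qed.

Let gcoefD k x y : gcoef k (x + y) = gcoef k x + gcoef k y.
Proof. by rewrite /gcoef poly_ofD mcoeffD. Qed.

(** Monomials of p and q have degree at least i and j times that of g. When they multiply to g^(i+j)
    both bounds are attained, and [split_power] leaves the single pair (g^i, g^j). *)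
Let mcoeff_powM i j (p q : {mpoly K[n]}) : (i + j < 3)%N -> supp i p -> supp j q ->
  (p * q)@_(g *+ (i + j))%MM = p@_(g *+ i)%MM * q@_(g *+ j)%MM.
Proof.
move=> ij3 hp hq; rewrite mcoeffM.
have H1 : (mdeg (g *+ i)%MM < (mdeg (g *+ (i + j))%MM).+1)%N.
  by rewrite ltnS !mdegMn leq_mul2l leq_addr orbT.
have H2 : (mdeg (g *+ j)%MM < (mdeg (g *+ (i + j))%MM).+1)%N.
  by rewrite ltnS !mdegMn leq_mul2l leq_addl orbT.
rewrite (bigD1 (BMultinom H1, BMultinom H2)) /=; last first.
  by apply/eqP/mnmP => l; rewrite mnmDE !mulmnE mulnDr.
rewrite big1 ?addr0 // => -[m1 m2] /= /andP[/eqP mE ne].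
apply/eqP; move: ne; apply: contraNT; rewrite mulf_eq0 negb_or => /andP[nz1 nz2].
have [_ l1] := hp _ nz1; have [_ l2] := hq _ nz2.
have := congr1 (wdeg w) mE; rewrite wdegD wdegMn mulnDr => wE.
have w1 : wdeg w m1 = (wdeg w g * i)%N by lia.
have w2 : wdeg w m2 = (wdeg w g * j)%N by lia.
have m1E : val m1 = (g *+ i)%MM by exact: split_power ij3 w1 (esym mE).
have m2E : val m2 = (g *+ j)%MM.
  apply: (@split_power j i _ m1); rewrite 1?addnC //.
  by rewrite addmC -mE addnC.
by rewrite xpair_eqE; apply/andP; split; apply/eqP/val_inj.
Qed.

Let gcoefM i j x y : (i + j < 3)%N -> supported i x -> supported j y ->
  gcoef (i + j) (x * y) = gcoef i x * gcoef j y.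
Proof. by rewrite /gcoef poly_ofM; apply: mcoeff_powM. Qed.

Let gr_coef k (z : assoc_graded A) : K := gcoef k (val (repr z))`_k.

Let gcoef0 k : gcoef k 0 = 0.
Proof. by rewrite /gcoef /poly_of /= mcoeff0. Qed.

(** The choice made by [repr] is harmless: two representatives differ in degree k by an element of
    m^(k+1), which [gcoef k] kills. *)
Let gr_coef_pi k p : gr_coef k (gr_pi p) = gcoef k (val p)`_k.
Proof.
rewrite /gr_coef; set r := repr _.
have : gr_pi (r - p) = 0 by rewrite gr_piB {1}/gr_pi reprK subrr.
move/gr_pi_eq0 => /(_ k) /supported_mpow /gcoef_supported.
have -> : val (r - p) = val r - val p by [].
rewrite coefB => h; rewrite -[RHS]add0r -h -gcoefD; congr gcoef.
by rewrite subrK.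
Qed.

Let gr_coefD k x y : gr_coef k (x + y) = gr_coef k x + gr_coef k y.
Proof.
have [p ->] := gr_pi_surj x; have [q ->] := gr_pi_surj y.
by rewrite -gr_piD !gr_coef_pi /= coefD gcoefD.
Qed.

Let gr_coef1 : gr_coef 0 1 = 1.
Proof. by rewrite -gr_pi1 gr_coef_pi /= coef1 /gcoef mulm0n /poly_of /= mcoeff1 eqxx. Qed.

Let gr_coefM k x y : (k < 3)%N ->
  gr_coef k (x * y) = \sum_(i < k.+1) gr_coef i x * gr_coef (k - i)%N y.
Proof.
have [p ->] := gr_pi_surj x; have [q ->] := gr_pi_surj y => k3.
rewrite -gr_piM !gr_coef_pi /= coefM (big_morph _ (gcoefD k) (gcoef0 k)).
apply: eq_bigr => i _; rewrite !gr_coef_pi.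
have ik : (i <= k)%N by rewrite -ltnS.
rewrite -{1}(subnKC ik) gcoefM ?subnKC //; exact: supported_mpow (reesP _ _).
Qed.

Let gr_coef_hcomp k d x : (k < 3)%N -> d != k -> hcomp d x -> gr_coef k x = 0.
Proof.
move=> _ dk [p [[a pa] ->]]; rewrite gr_coef_pi pa coefZ coefXn eq_sym.
by rewrite (negPf dk) mulr0 gcoef0.
Qed.

Let mono_subproof m : wdeg w m = wdeg w g ->
  'X_[m] \in veronese_pred (A := wpoly K w) (wdeg w g).
Proof.
move=> mE; apply/asboolP/sums_of1; exists (wdeg w g) => //=.
by rewrite /wcomp -mE dhomogX.
Qed.

Let mono m (mE : wdeg w m = wdeg w g) : A := VeroneseRing (mono_subproof mE).

Let mono_irrelevant m (mE : wdeg w m = wdeg w g) : irrelevant (mono mE).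
Proof.
apply: sums_of1; exists 1%N => //=; rewrite /vcomp muln1 /= /wcomp.
by rewrite -[X in _ \is X.-homog for _]mE dhomogX.
Qed.

Let mono_rees_subproof m (mE : wdeg w m = wdeg w g) :
  mono mE *: 'X \in rees_pred (A := A).
Proof.
apply/asboolP => k; rewrite coefZ coefX.
have [->|_] := eqVneq; last by rewrite mulr0; apply: mpow0.
apply: sums_of1; exists (mono mE), 1; split=> //; exact: mono_irrelevant.
Qed.

Let gr_mono m (mE : wdeg w m = wdeg w g) : assoc_graded A :=
  gr_pi (Rees (mono_rees_subproof mE)).

Let gr_mono_irrelevant m (mE : wdeg w m = wdeg w g) : irrelevant (gr_mono mE).
Proof.
apply: sums_of1; exists 1%N => //; exists (Rees (mono_rees_subproof mE)).
by split=> //; exists (mono mE); rewrite expr1.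
Qed.

Lemma not_nonstandard_koszul_cubic (h1 h2 h3 : 'X_{1..n}) :
  wdeg w h1 = wdeg w g -> wdeg w h2 = wdeg w g -> wdeg w h3 = wdeg w g ->
  (h1 + h2 + h3 = g *+ 3)%MM -> h1 <> g -> ~ nonstandard_koszul A.
Proof.
move=> h1E h2E h3E hE h1g.
pose gE := erefl (wdeg w g).
(* The element sent to 0 is h1 h2: it is concentrated in degree 2, and h1 + h2 = 2g would force h1 =
   g. *)
apply: (not_koszul_cubic gr_coefD gr_coef1 gr_coefM gr_coef_hcomp
  (g := gr_mono gE) (p := gr_mono h1E * gr_mono h2E) (q := gr_mono h3E)).
- exact: gr_mono_irrelevant.
- exact: gr_mono_irrelevant.
- rewrite /gr_mono -!gr_piM; congr gr_pi; apply: val_inj => /=.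
  have cubeE (a b c : A) :
      a *: 'X * (b *: 'X) * (c *: 'X) = (a * b * c) *: 'X^3 :> {poly A}.
    by rewrite -!mul_polyC !polyCM; ring.
  rewrite !cubeE; congr (_ *: _); apply: val_inj => /=.
  rewrite -!mpolyXD hE; congr mpolyX; apply/mnmP => i; rewrite mulmnE !mnmDE.
  by lia.
- by rewrite gr_coef_pi /= coefZ coefX mulr1 /gcoef /= mcoeffX mulm1n eqxx.
- move=> k k3; rewrite -gr_piM gr_coef_pi /=.
  rewrite -scalerAl -scalerAr scalerA -expr2 coefZ coefXn.
  have [->|_] := eqVneq; last by rewrite mulr0 gcoef0.
  rewrite mulr1 /gcoef /poly_of /= -mpolyXD mcoeffX.
  by case: eqP => // /(g2_unique h1E).
Qed.

End MonomialCriterion.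

(** * Weights with non-Koszul Veronese subrings *)

(** This gives the uniqueness of g^2 = h h'. For (y, z) = (1, 1) the form is x + s + t - n, kept off
    -n by |x| <= max(s, t) < s + t. For (0, 1), where 3(t - m) = s + 2t - n, the two inequalities
    say exactly that 3 max(s, t) + s + 2t < n. The other nonzero pairs, up to sign, leave more
    room. *)
Lemma small_lattice_point_eq0 (n s t m x y z j : int) :
  1 <= s -> 1 <= t -> 4 * s + 2 * t < n -> s + 5 * t < n ->
  3 * m + s = n + t ->
  `|x| <= Num.max s t -> `|y| <= 1 -> `|z| <= 1 ->
  x + (t - 2 * m) * y + (t - m) * z = n * j -> [/\ x = 0, y = 0 & z = 0].
Proof.
move=> s1 t1 h1 h2 mE xW y1 z1 lE.
have njP : 2 * n <= n * j \/ n * j = n \/ n * j = 0 \/ n * j = - n \/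
    n * j <= - (2 * n).
  have [j2|[->|[->|[->|j2]]]] :
      2 <= j \/ j = 1 \/ j = 0 \/ j = -1 \/ j <= - 2 by lia.
  - by left; nia.
  - by right; left; lia.
  - by do 2 right; left; lia.
  - by do 3 right; left; lia.
  - by do 4 right; nia.
move: (n * j) njP lE => nj njP lE.
have [? | [? | ?]] : y = 0 \/ y = 1 \/ y = -1 by lia.
all: have [? | [? | ?]] : z = 0 \/ z = 1 \/ z = -1 by lia.
all: subst; try (exfalso; lia).
by split=> //; lia.
Qed.

(** The unknowns are the shifts of the exponent of x1 that give h1, h2, h3 the degree of g, namely
    for the lattice vectors (s+t, -1, -1), (-s, 2, -1), (-t, -1, 2). The two congruences make them
    integers, and they sum to 0 since the vectors do. *)
Lemma cubic_relation_heads (n a b c s t m j k : int) : 3 * m + s = n + t ->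
  b + a * (2 * m) = a * t + j * n -> c + a * m = a * t + k * n ->
  exists x y z, [/\ n * x = b + c - a * (s + t), n * y = a * s - 2 * b + c,
    n * z = a * t + b - 2 * c & x + y + z = 0].
Proof.
move=> mE bE cE; exists (j + k - a), (k - 2 * j + a), (j - 2 * k).
have sE : s = n + t - 3 * m by lia.
have {}bE : b = a * t + j * n - a * (2 * m) by lia.
have {}cE : c = a * t + k * n - a * m by lia.
by split; rewrite ?bE ?cE ?sE; ring.
Qed.

Section CubicRelation.
Import mpoly.

Lemma sum_I4 (i0 i1 i2 i3 : 'I_4) (F : 'I_4 -> nat) : uniq [:: i0; i1; i2; i3] ->
  (\sum_i F i = F i0 + F i1 + F i2 + F i3)%N.
Proof.
move=> u; have -> : (\sum_i F i = \sum_(i <- [:: i0; i1; i2; i3]) F i)%N.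
  apply: perm_big; apply: uniq_perm => //; first exact: index_enum_uniq.
  have := @uniq_min_size _ [:: i0; i1; i2; i3] (enum 'I_4) u.
  case=> [i||_ h]; first by rewrite mem_enum.
    by rewrite size_enum_ord.
  by move=> i; rewrite mem_index_enum h mem_enum.
by rewrite !big_cons big_nil addn0 !addnA.
Qed.

Variables (K : fieldType) (w : 'I_4 -> nat) (i0 i1 i2 i3 : 'I_4).
Hypothesis i_uniq : uniq [:: i0; i1; i2; i3].
Hypothesis w_gt0 : forall i, (0 < w i)%N.

Let mon x0 x1 x2 x3 : 'X_{1..4} :=
  [multinom if i == i0 then x0 else if i == i1 then x1 else
            if i == i2 then x2 else x3 | i < 4].

Let monE x0 x1 x2 x3 : [/\ mon x0 x1 x2 x3 i0 = x0, mon x0 x1 x2 x3 i1 = x1,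
  mon x0 x1 x2 x3 i2 = x2 & mon x0 x1 x2 x3 i3 = x3].
Proof.
move: i_uniq; rewrite /= !inE !negb_or -!andbA.
case/and5P=> n01 n02 n03 n12 /and3P[n13 n23 _].
rewrite !mnmE !eqxx ![i1 == _]eq_sym ![i2 == _]eq_sym ![i3 == _]eq_sym.
by rewrite (negPf n01) (negPf n02) (negPf n03) (negPf n12) (negPf n13) (negPf n23).
Qed.

Let wdegE m :
  wdeg w m = (w i0 * m i0 + w i1 * m i1 + w i2 * m i2 + w i3 * m i3)%N.
Proof. exact: sum_I4. Qed.

Let mnm_eq (m m' : 'X_{1..4}) :
  m i0 = m' i0 -> m i1 = m' i1 -> m i2 = m' i2 -> m i3 = m' i3 -> m = m'.
Proof.
move=> e0 e1 e2 e3; apply/mnmP => i.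
have := @uniq_min_size _ [:: i0; i1; i2; i3] (enum 'I_4) i_uniq.
case=> [j||_ /(_ i)]; first by rewrite mem_enum.
  by rewrite size_enum_ord.
by rewrite mem_enum !inE => /or4P[] /eqP->.
Qed.

(* With W = max(s, t), the monomial g = (G, W, 1, 1) satisfies the cubic relation
   g^3 = (G + p0, W + s + t, 0, 0) (G + q0, W - s, 3, 0) (G + r0, W - t, 0, 3). *)
Lemma veronese_not_koszul (s t m e0 : nat) : coprime (w i1) (w i0) ->
  (0 < s)%N -> (0 < t)%N ->
  (4 * s + 2 * t < w i0)%N -> (s + 5 * t < w i0)%N -> (3 * m + s = w i0 + t)%N ->
  w i2 + w i1 * (2 * m) = w i1 * t %[mod w i0] ->
  w i3 + w i1 * m = w i1 * t %[mod w i0] ->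
  exists e (e_gt0 : (0 < e)%N),
    (e0 <= e)%N /\ ~ nonstandard_koszul (veronese (wpoly K w) e_gt0).
Proof.
set n := w i0; set a := w i1; set b := w i2; set c := w i3.
move=> cop s1 t1 hs1 hs2 mE bE cE.
have [be beE] : exists be : int, b%:Z + a%:Z * (2 * m%:Z) = a%:Z * t%:Z + be * n%:Z.
  have /eqP : (b + a * (2 * m))%N%:Z = (a * t)%N%:Z %[mod n]%Z.
    by rewrite !modz_nat bE.
  rewrite eqz_mod_dvd => /dvdzP[be E]; exists be; lia.
have [ga gaE] : exists ga : int, c%:Z + a%:Z * m%:Z = a%:Z * t%:Z + ga * n%:Z.
  have /eqP : (c + a * m)%N%:Z = (a * t)%N%:Z %[mod n]%Z.
    by rewrite !modz_nat cE.
  rewrite eqz_mod_dvd => /dvdzP[ga E]; exists ga; lia.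
pose W := maxn s t.
have mE' : 3 * m%:Z + s%:Z = n%:Z + t%:Z by lia.
have [p0 [q0 [r0 [p0E q0E r0E pqr]]]] := cubic_relation_heads mE' beE gaE.
(* A large G keeps the exponents of x1 nonnegative, so that [absz] changes nothing, and pushes the
   degree of g past [e0]. *)
have [G [Ge Gp Gq Gr]] :
    exists G, [/\ e0 <= G, absz p0 <= G, absz q0 <= G & absz r0 <= G]%N.
  exists (e0 + absz p0 + absz q0 + absz r0)%N; clear; split; lia.
pose g := mon G W 1 1; pose h1 := mon (absz (G%:Z + p0)) (W + s + t) 0 0.
pose h2 := mon (absz (G%:Z + q0)) (W - s) 3 0; pose h3 := mon (absz (G%:Z + r0)) (W - t) 0 3.
have [[g0 g1 g2 g3] [h10 h11 h12 h13]] := (monE G W 1 1, monE (absz (G%:Z + p0)) (W + s + t) 0 0).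
have [[h20 h21 h22 h23] [h30 h31 h32 h33]] :=
  (monE (absz (G%:Z + q0)) (W - s) 3 0, monE (absz (G%:Z + r0)) (W - t) 0 3).
have n0 : (0 < n)%N := w_gt0 i0.
have GpE x : (absz x <= G)%N -> n%:Z * (absz (G%:Z + x))%:Z = n%:Z * G%:Z + n%:Z * x.
  by move=> xG; rewrite -mulrDr; congr (_ * _); move: xG; clear; lia.
have gE : wdeg w g = (n * G + a * W + b + c)%N.
  by rewrite wdegE g0 g1 g2 g3 !muln1.
have e_gt0 : (0 < wdeg w g)%N by rewrite gE addn_gt0 (w_gt0 i3) orbT.
exists (wdeg w g), e_gt0; split.
  rewrite gE -!addnA; apply: leq_trans (leq_addr _ _).
  exact: leq_trans (leq_pmull _ n0).
apply: (@not_nonstandard_koszul_cubic K 4 w g w_gt0 e_gt0 _ h1 h2 h3).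
- move=> m1 m2 m1E m12.
  have m1g i : (m1 i <= 2 * g i)%N.
    by rewrite mulnC -mulmnE -m12 mnmDE leq_addr.
  move: m1E; rewrite gE wdegE -/n -/a -/b -/c.
  move: (m1g i0) (m1g i1) (m1g i2) (m1g i3); rewrite g0 g1 g2 g3 => l0 l1 l2 l3 m1E.
  (* As m1 divides g^2, its offset from g lies in the box |x| <= W, |y|, |z| <= 1. Equality of
     degrees puts it in the lattice once the unit [a] modulo n is cancelled. *)
  pose x := (m1 i1)%:Z - W%:Z; pose y := (m1 i2)%:Z - 1; pose z := (m1 i3)%:Z - 1.
  have [j jE] : exists j, x + (t%:Z - 2 * m%:Z) * y + (t%:Z - m%:Z) * z = n%:Z * j.
    have : (n%:Z %| a%:Z * (x + (t%:Z - 2 * m%:Z) * y + (t%:Z - m%:Z) * z))%Z.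
      apply/dvdzP; exists (G%:Z - (m1 i0)%:Z - be * y - ga * z).
      have bE' : b%:Z = a%:Z * t%:Z + be * n%:Z - a%:Z * (2 * m%:Z).
        by move: beE; clear; lia.
      have cE' : c%:Z = a%:Z * t%:Z + ga * n%:Z - a%:Z * m%:Z.
        by move: gaE; clear; lia.
      have m1E' : n%:Z * (m1 i0)%:Z + a%:Z * (m1 i1)%:Z + b%:Z * (m1 i2)%:Z
          + c%:Z * (m1 i3)%:Z = n%:Z * G%:Z + a%:Z * W%:Z + b%:Z + c%:Z.
        by move: m1E; clear; lia.
      by move: m1E'; rewrite /x /y /z bE' cE'; clear; lia.
    rewrite Gauss_dvdzr; last by rewrite coprimezE !absz_nat coprime_sym.
    by case/dvdzP=> j ->; exists j; rewrite mulrC.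
  have [|||||||x0 y0 z0] :=
    @small_lattice_point_eq0 n%:Z s%:Z t%:Z m%:Z x y z j _ _ _ _ mE' _ _ _ jE.
  - by move: s1; clear; lia.
  - by move: t1; clear; lia.
  - by move: hs1; clear; lia.
  - by move: hs2; clear; lia.
  - by move: l1; rewrite /x /W; clear; lia.
  - by move: l2; rewrite /y; clear; lia.
  - by move: l3; rewrite /z; clear; lia.
  have e1 : m1 i1 = W by move: x0; rewrite /x; clear; lia.
  have e2 : m1 i2 = 1%N by move: y0; rewrite /y; clear; lia.
  have e3 : m1 i3 = 1%N by move: z0; rewrite /z; clear; lia.
  move: m1E; rewrite e1 e2 e3 !muln1 => /addIn/addIn/addIn/eqP.
  rewrite eqn_pmul2l // => /eqP e_0.
  by apply: mnm_eq; rewrite ?g0 ?g1 ?g2 ?g3.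
- rewrite gE wdegE h10 h11 h12 h13 -/n -/a -/b -/c.
  have := GpE p0 Gp; rewrite p0E.
  by clear; lia.
- rewrite gE wdegE h20 h21 h22 h23 -/n -/a -/b -/c.
  have := GpE q0 Gq; rewrite q0E.
  have sW : (a * (W - s) + a * s = a * W)%N by rewrite -mulnDr subnK ?leq_maxl.
  by move: sW; clear; lia.
- rewrite gE wdegE h30 h31 h32 h33 -/n -/a -/b -/c.
  have := GpE r0 Gr; rewrite r0E.
  have tW : (a * (W - t) + a * t = a * W)%N by rewrite -mulnDr subnK ?leq_maxr.
  by move: tW; clear; lia.
- have GxE x : (absz x <= G)%N -> (absz (G%:Z + x))%:Z = G%:Z + x by clear; lia.
  apply: mnm_eq; rewrite mulmnE !mnmDE.
  + rewrite h10 h20 h30 g0; move: (GxE p0 Gp) (GxE q0 Gq) (GxE r0 Gr) pqr.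
    by clear; lia.
  + rewrite h11 h21 h31 g1; move: (leq_maxl s t) (leq_maxr s t); rewrite -/W.
    by clear; lia.
  + by rewrite h12 h22 h32 g2.
  + by rewrite h13 h23 h33 g3.
- by move=> /(congr1 (fun m : 'X_{1..4} => m i2)); rewrite h12 g2.
Qed.

Lemma bad_of_residues (s t m : nat) : coprime (w i1) (w i0) ->
  (0 < s)%N -> (0 < t)%N ->
  (4 * s + 2 * t < w i0)%N -> (s + 5 * t < w i0)%N -> (3 * m + s = w i0 + t)%N ->
  w i2 + w i1 * (2 * m) = w i1 * t %[mod w i0] ->
  w i3 + w i1 * m = w i1 * t %[mod w i0] -> bad K w.
Proof.
move=> cop s0 t0 h1 h2 mE bE cE; split=> // [|[e0 koszul_from_e0]].
  apply/eqP; rewrite -dvdn1 -[X in (_ %| X)%N](eqP cop) dvdn_gcd.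
  have gcd_dvd i : (\big[gcdn/0]_(i < 4) w i %| w i)%N.
    by rewrite (bigD1 i) //= dvdn_gcdl.
  by rewrite !gcd_dvd.
have [e [e_gt0 [e0e]]] := veronese_not_koszul e0 cop s0 t0 h1 h2 mE bE cE.
by apply; apply: koszul_from_e0.
Qed.

End CubicRelation.

(** * The parameter region and its residues modulo n *)

Section Counting.
Local Open Scope nat_scope.

(* The pairs (s, t) parametrizing the family: with m = (n + t - s) / 3, the last
   two weights are a (t - 2m) and a (t - m) modulo n. *)
Definition region n : {set 'I_n * 'I_n} :=
  [set x : 'I_n * 'I_n | [&& 0 < x.1, 0 < x.2, 4 * x.1 + 2 * x.2 < n, x.1 + 5 * x.2 < n
             & 3 %| n + x.2 + 2 * x.1]].

(* For n = 180 q, a lower bound for the number of t such that (s, t) lies in the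
   region for all s in {3j + 1, 3j + 2, 3j + 3}; exactly one of these s satisfies the
   congruence.  The change of formula is at the vertex s = t = n / 6. *)
Definition region_row q j : nat :=
  if j.+1 <= 10 * q then (180 * q - 3 * j.+1 - 1) %/ 5 else 90 * q - 6 * j.+1 - 1.

Lemma region_row_le q j y : y < region_row q j ->
  12 * j.+1 + 2 * y.+1 < 180 * q /\ 3 * j.+1 + 5 * y.+1 < 180 * q.
Proof. by rewrite /region_row; case: ifP; lia. Qed.

(** The remainder in [S] selects, among three consecutive values, the s congruent to n + t modulo 3,
    which is the condition 3 | n + t + 2s. The inequalities for 180 q only get weaker for larger
    n. *)
Lemma card_region_ge q n : 180 * q <= n ->
  \sum_(j < 15 * q) region_row q j <= #|region n|.
Proof.
move=> qn.
pose T := {j : 'I_(15 * q) & 'I_(region_row q j)}.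
pose S (x : T) : nat := 3 * tag x + 1 + (n + (tagged x).+1 + 2) %% 3.
have row_lt (x : T) := region_row_le (ltn_ord (tagged x)).
have S_lt (x : T) : S x < n.
  have [] := row_lt x; rewrite /S; have := ltn_pmod (n + (tagged x).+1 + 2) (isT : 0 < 3).
  by move: qn; clear; lia.
have t_lt (x : T) : (tagged x).+1 < n.
  by have [] := row_lt x; move: qn; clear; lia.
pose f (x : T) : 'I_n * 'I_n := (Ordinal (S_lt x), Ordinal (t_lt x)).
have f_inj : injective f.
  move=> [j y] [j' y'] [/= SE tE].
  have jE : j = j'.
    apply: val_inj; move: SE; rewrite /S /= tE; clear; lia.
  by subst j'; congr existT; apply: val_inj.
have -> : \sum_(j < 15 * q) region_row q j = #|{: T}|.
  rewrite card_tagged sumnE big_map big_enum /=.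
  by apply: eq_bigr => j _; rewrite card_ord.
rewrite -cardsT -(card_imset _ f_inj) subset_leq_card //.
apply/subsetP => _ /imsetP[x _ ->]; rewrite inE /= /S.
have [h1 h2] := row_lt x; have r3 := ltn_pmod (n + (tagged x).+1 + 2) (isT : 0 < 3).
have := divn_eq (n + (tagged x).+1 + 2) 3.
move: qn h1 h2 r3; move: (_ %% 3) (_ %/ 3) => r d.
move: (nat_of_ord (tag x)) (nat_of_ord (tagged x)) => j y; clear.
by move=> qn h1 h2 r3 dE; apply/and4P; split; lia.
Qed.

End Counting.

Lemma multiple_small_eq0 (n x r : int) : `|r| < n -> r = x * n -> x = 0.
Proof.
move=> rn rE; have [x0|[//|x0]] : x <= -1 \/ x = 0 \/ 1 <= x by lia.
  by nia.
by nia.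
Qed.

(** The two residues differ by m, and |m - m'| < n gives m = m'; then |t - t'| < n gives t = t'. *)
Lemma region_param_inj (n s t m s' t' m' x y : int) :
  0 < s -> 0 < t -> 0 < s' -> 0 < t' -> 4 * s + 2 * t < n -> s + 5 * t < n ->
  4 * s' + 2 * t' < n -> s' + 5 * t' < n ->
  3 * m + s = n + t -> 3 * m' + s' = n + t' ->
  (t - 2 * m) - (t' - 2 * m') = x * n -> (t - m) - (t' - m') = y * n ->
  s = s' /\ t = t'.
Proof.
move=> s0 t0 s0' t0' h1 h2 h1' h2' mE mE' xE yE.
have xy0 : x - y = 0 by apply: (@multiple_small_eq0 n _ (m' - m)); lia.
have y0 : y = 0 by apply: (@multiple_small_eq0 n _ (t - t')); lia.
by subst y; split; lia.
Qed.

(** Exchanging the residues would make m + m' a multiple of n, but 0 < m + m' < n. Hence the two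
    orders of the last two weights give disjoint families. *)
Lemma region_param_swap (n s t m s' t' m' x y : int) :
  0 < s -> 0 < t -> 0 < s' -> 0 < t' -> 4 * s + 2 * t < n -> s + 5 * t < n ->
  4 * s' + 2 * t' < n -> s' + 5 * t' < n ->
  3 * m + s = n + t -> 3 * m' + s' = n + t' ->
  (t - 2 * m) - (t' - m') = x * n -> (t - m) - (t' - 2 * m') = y * n -> False.
Proof.
move=> s0 t0 s0' t0' h1 h2 h1' h2' mE mE' xE yE.
have xy0 : x - y = 0 by apply: (@multiple_small_eq0 n _ (- m - m')); lia.
lia.
Qed.

Section ResidueFamily.
Local Open Scope nat_scope.

Definition vec4 n a b c : 'I_4 -> nat := fun i => nth 0 [:: n; a; b; c] i.

(* resU and resV are t - 2m and t - m, shifted by multiples of n so as to avoid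
   truncated subtraction. *)
Definition third n s t := (n + t - s) %/ 3.
Definition resU n s t := t + 2 * (n - third n s t).
Definition resV n s t := t + (n - third n s t).

Lemma regionP n (x : 'I_n * 'I_n) : x \in region n ->
  [/\ 0 < x.1, 0 < x.2, 4 * x.1 + 2 * x.2 < n, x.1 + 5 * x.2 < n
    & 3 * third n x.1 x.2 + x.1 = n + x.2].
Proof.
rewrite inE /third => /and5P[s0 t0 h1 h2 /dvdnP[k kE]]; split=> //.
by have := ltn_ord x.1; move: kE; clear; lia.
Qed.

(** Ensures that weights with these residues, times a unit, are never 0. *)
Lemma res_not_dvd n s t : 0 < s -> 0 < t -> 4 * s + 2 * t < n ->
  s + 5 * t < n -> 3 * third n s t + s = n + t ->
  ~~ (n %| resU n s t) /\ ~~ (n %| resV n s t).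
Proof.
move=> s0 t0 h1 h2 mE; rewrite /resU /resV; split; apply/negP => /dvdnP[k kE].
  have [k0|[k1|k2]] : k = 0 \/ k = 1 \/ 2 <= k by lia.
  - by subst k; lia.
  - by subst k; lia.
  - by nia.
have [k0|k1] : k = 0 \/ 1 <= k by lia.
- by subst k; lia.
- by nia.
Qed.

Lemma res_bad K n a b c (x : 'I_n * 'I_n) (swap : bool) :
  x \in region n -> coprime a n -> 0 < a ->
  b = a * resU n x.1 x.2 %[mod n] -> c = a * resV n x.1 x.2 %[mod n] ->
  bad K (if swap then vec4 n a c b else vec4 n a b c).
Proof.
move=> /regionP[]; move: (nat_of_ord x.1) (nat_of_ord x.2) => s t.
move=> s0 t0 h1 h2 mE cop a0 bE cE.
have [nU nV] := res_not_dvd s0 t0 h1 h2 mE.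
have b0 : 0 < b.
  rewrite lt0n; apply: contraNneq nU => b0.
  by rewrite -(@Gauss_dvdr n a) 1?coprime_sym // /dvdn -bE b0 mod0n.
have c0 : 0 < c.
  rewrite lt0n; apply: contraNneq nV => c0.
  by rewrite -(@Gauss_dvdr n a) 1?coprime_sym // /dvdn -cE c0 mod0n.
have n0 : 0 < n by exact: leq_ltn_trans (leq0n _) h2.
have w_gt0 i : 0 < (if swap then vec4 n a c b else vec4 n a b c) i.
  by case: swap i => -[[|[|[|[|]]]]] //= i4; rewrite /vec4 /=.
have mn : third n s t <= n by move: h1 h2 mE; clear; lia.
have bE' : b + a * (2 * third n s t) = a * t %[mod n].
  rewrite -modnDml bE modnDml /resU -mulnDr -addnA -mulnDr subnK //.
  by rewrite mulnDr mulnA addnC modnMDl.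
have cE' : c + a * third n s t = a * t %[mod n].
  rewrite -modnDml cE modnDml /resV -mulnDr -addnA subnK //.
  by rewrite mulnDr addnC modnMDl.
pose o k (k4 : k < 4) : 'I_4 := Ordinal k4.
by case: swap w_gt0 => w_gt0;
  [ apply: (@bad_of_residues K _ (o 0 isT) (o 1 isT) (o 3 isT) (o 2 isT)
             isT w_gt0 s t (third n s t))
  | apply: (@bad_of_residues K _ (o 0 isT) (o 1 isT) (o 2 isT) (o 3 isT)
             isT w_gt0 s t (third n s t)) ].
Qed.

End ResidueFamily.

(** * Counting *)

Lemma eqmod_cancel (n a u v : nat) : coprime a n ->
  ((a * u) %% n = (a * v) %% n)%N -> exists x : int, u%:Z - v%:Z = x * n%:Z.
Proof.
move=> cop uv; suff /dvdzP : (n%:Z %| u%:Z - v%:Z)%Z by [].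
rewrite -(@Gauss_dvdzr n a); last by rewrite coprimezE !absz_nat coprime_sym.
by rewrite mulrBr -!PoszM -eqz_mod_dvd !modz_nat uv.
Qed.

Lemma mixed_radix_inj (n i j r s : nat) : (r < n)%N -> (s < n)%N ->
  (i * n + r = j * n + s)%N -> i = j /\ r = s.
Proof.
move=> rn sn E; have n0 : (0 < n)%N by exact: leq_ltn_trans rn.
split; last by have := congr1 (modn^~ n) E; rewrite !modnMDl !modn_small.
by have := congr1 (divn^~ n) E; rewrite /= !divnMDl // !divn_small // !addn0.
Qed.

Lemma res_inj (n a : nat) (x y : 'I_n * 'I_n) : coprime a n ->
  x \in region n -> y \in region n ->
  ((a * resU n x.1 x.2) %% n = (a * resU n y.1 y.2) %% n)%N ->
  ((a * resV n x.1 x.2) %% n = (a * resV n y.1 y.2) %% n)%N -> x = y.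
Proof.
move=> cop /regionP[s0 t0 h1 h2 mE] /regionP[s0' t0' h1' h2' mE'].
move=> /(eqmod_cancel cop)[u uE] /(eqmod_cancel cop)[v vE].
have [] := @region_param_inj n x.1 x.2 (third n x.1 x.2) y.1 y.2 (third n y.1 y.2) u v.
all: try by [move: s0 t0 s0' t0' h1 h2 h1' h2'; clear; lia].
- by move: mE; clear; lia.
- by move: mE'; clear; lia.
- rewrite -uE /resU; move: h1 h2 h1' h2' mE mE'; clear; lia.
- rewrite -vE /resV; move: h1 h2 h1' h2' mE mE'; clear; lia.
case: x y {s0 t0 h1 h2 mE s0' t0' h1' h2' mE' uE vE} => [x1 x2] [y1 y2] /= [xy1] [xy2].
by congr pair; apply: val_inj.
Qed.

Lemma res_swap (n a : nat) (x y : 'I_n * 'I_n) : coprime a n ->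
  x \in region n -> y \in region n ->
  ((a * resU n x.1 x.2) %% n = (a * resV n y.1 y.2) %% n)%N ->
  ((a * resV n x.1 x.2) %% n = (a * resU n y.1 y.2) %% n)%N -> False.
Proof.
move=> cop /regionP[s0 t0 h1 h2 mE] /regionP[s0' t0' h1' h2' mE'].
move=> /(eqmod_cancel cop)[u uE] /(eqmod_cancel cop)[v vE].
(* [resU] is shifted by 2n and [resV] by n; [u - 1] and [v + 1] undo the mismatch. *)
apply: (@region_param_swap n x.1 x.2 (third n x.1 x.2) y.1 y.2 (third n y.1 y.2) (u - 1) (v + 1)).
all: try by [move: s0 t0 s0' t0' h1 h2 h1' h2'; clear; lia].
- by move: mE; clear; lia.
- by move: mE'; clear; lia.
- move: uE; rewrite /resU /resV; move: h1 h2 h1' h2' mE mE'; clear; lia.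
- move: vE; rewrite /resU /resV; move: h1 h2 h1' h2' mE mE'; clear; lia.
Qed.

Section BadCount.
Variable K : fieldType.
Local Open Scope nat_scope.

(** Each of the last two weights runs over k full periods modulo n. The two period indices, the
    order of the weights and the region point are recovered from the pair by division with
    remainder, [res_inj] and [res_swap]. *)
Lemma card_block N n a k : coprime a n -> 0 < a -> k * n <= N ->
  2 * k ^ 2 * #|region n| <=
  #|[set y : 'I_N.+1 * 'I_N.+1 | `[< bad K (vec4 n a y.1 y.2) >]]|.
Proof.
move=> cop a0 knN.
have [->|n0] := posnP n.
  rewrite (_ : #|_| = 0) ?muln0 //; apply: eq_card0 => -[[x1 //]].
pose D := [set p : ('I_k * 'I_k * bool) * ('I_n * 'I_n) | p.2 \in region n].
have memD p : (p \in D) = (p.2 \in region n) by rewrite inE.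
have cardD : 2 * k ^ 2 * #|region n| = #|D|.
  have -> : D = setX [set: 'I_k * 'I_k * bool] (region n).
    by apply/setP => p; rewrite !inE.
  by rewrite cardsX cardsT !card_prod !card_ord card_bool -mulnn (mulnC 2).
pose B (p : ('I_k * 'I_k * bool) * ('I_n * 'I_n)) :=
  p.1.1.1 * n + (a * resU n p.2.1 p.2.2) %% n.
pose C (p : ('I_k * 'I_k * bool) * ('I_n * 'I_n)) :=
  p.1.1.2 * n + (a * resV n p.2.1 p.2.2) %% n.
have lt_N (i : 'I_k) r : i * n + r %% n < N.+1.
  apply: leq_trans (_ : i.+1 * n <= _); first by rewrite mulSnr ltn_add2l ltn_mod.
  by rewrite leqW // (leq_trans _ knN) // leq_mul2r ltn_ord orbT.
pose f p : 'I_N.+1 * 'I_N.+1 :=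
  if p.1.2 then (Ordinal (lt_N p.1.1.2 _ : C p < _), Ordinal (lt_N p.1.1.1 _ : B p < _))
  else (Ordinal (lt_N p.1.1.1 _ : B p < _), Ordinal (lt_N p.1.1.2 _ : C p < _)).
have f_inj : {in D &, injective f}.
  move=> [[[i i'] o] x] [[[j j'] o'] y]; rewrite !memD /f /B /C /=.
  case: o o' => [] [] xR yR [] /mixed_radix_inj[]; rewrite ?ltn_mod // => e1 e2;
    move=> /mixed_radix_inj[]; rewrite ?ltn_mod // => e3 e4.
  - by rewrite (res_inj cop xR yR) // (val_inj e1) (val_inj e3).
  - by case: (res_swap cop xR yR).
  - by case: (res_swap cop xR yR).
  - by rewrite (res_inj cop xR yR) // (val_inj e1) (val_inj e3).
rewrite cardD -(card_in_imset f_inj) subset_leq_card //.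
apply/subsetP => _ /imsetP[[[[i i'] o] x] + ->]; rewrite memD inE /= => xR.
apply/asboolP; rewrite /f /B /C /=.
have := @res_bad K n a (i * n + (a * resU n x.1 x.2) %% n)
  (i' * n + (a * resV n x.1 x.2) %% n) x o xR cop a0.
by rewrite !modnMDl !modn_mod => /(_ erefl erefl); case: o.
Qed.

Lemma bad_count_ge N :
  \sum_(n < N.+1) \sum_(a < N.+1)
     #|[set y : 'I_N.+1 * 'I_N.+1 | `[< bad K (vec4 n a y.1 y.2) >]]|
  <= bad_count K N.
Proof.
pose I := 'I_N.+1.
pose mk (p : (I * I) * (I * I)) : {ffun 'I_4 -> I} :=
  [ffun i : 'I_4 => nth ord0 [:: p.1.1; p.1.2; p.2.1; p.2.2] i].
have mkE p i : nat_of_ord (mk p i) = vec4 p.1.1 p.1.2 p.2.1 p.2.2 i.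
  by rewrite ffunE /vec4; case: i => -[|[|[|[|]]]].
have mk_inj : injective mk.
  move=> [[n a] [b c]] [[n' a'] [b' c']] /ffunP E.
  have E4 k (k4 : k < 4) := E (Ordinal k4).
  have := E4 0 isT; have := E4 1 isT; have := E4 2 isT; have := E4 3 isT.
  by rewrite !ffunE /= => -> -> -> ->.
pose D := [set p : (I * I) * (I * I) | `[< bad K (vec4 p.1.1 p.1.2 p.2.1 p.2.2) >]].
have -> : \sum_(n < N.+1) \sum_(a < N.+1)
     #|[set y : I * I | `[< bad K (vec4 n a y.1 y.2) >]]| = #|D|.
  rewrite pair_big /= -sum1_card.
  under eq_bigr => q _ do rewrite -sum1_card.
  rewrite pair_big_dep /=; apply: eq_bigl => p; by rewrite !inE.
rewrite -(card_imset _ mk_inj) subset_leq_card //.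
apply/subsetP => _ /imsetP[p + ->]; rewrite !inE => /asboolP badp.
apply/asboolP; suff -> : (fun i => nat_of_ord (mk p i)) = vec4 p.1.1 p.1.2 p.2.1 p.2.2 by [].
by apply/funext => i; apply: mkE.
Qed.

End BadCount.

(** * Summation over the first two weights and removal of non-coprime pairs *)

Section UnionBound.
Local Open Scope nat_scope.

(** Rows are bounded below by linear functions on either side of the vertex j = 10 q. The main term
    405 q^2 is n^2/80 for n = 180 q: the quadrilateral has area 3/80, and the congruence modulo 3
    keeps one third. *)
Lemma region_row_sum q :
  2025 * q ^ 2 <= 5 * (\sum_(j < 15 * q) region_row q j) + 165 * q.
Proof.
have row1 J : J <= 10 * q ->
    360 * q * J <= 10 * (\sum_(j < J) region_row q j) + 3 * J ^ 2 + 13 * J.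
  elim: J => [|J IH] Jq; first by rewrite muln0.
  have TJ : 180 * q <= 5 * region_row q J + 3 * J + 8.
    by rewrite /region_row Jq; move: Jq; clear; lia.
  have {IH} := IH (ltnW Jq); rewrite big_ord_recr /=.
  by move: (\sum_(_ < _) _) (region_row q J) TJ => s T; clear; nia.
have row2 J : J <= 5 * q -> 10 * (\sum_(j < 10 * q) region_row q j) + 300 * q * J
    <= 10 * (\sum_(j < 10 * q + J) region_row q j) + 30 * J ^ 2 + 40 * J.
  elim: J => [|J IH] Jq; first by rewrite addn0; lia.
  have TJ : 30 * q <= region_row q (10 * q + J) + 6 * J + 7.
    by rewrite /region_row ifF; move: Jq; clear; lia.
  have {IH} := IH (ltnW Jq); rewrite addnS big_ord_recr /=.
  move: (\sum_(_ < 10 * q) _) (\sum_(_ < 10 * q + J) _) (region_row q _) TJ => s s' T.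
  by clear; nia.
have := row1 _ (leqnn _); have := row2 _ (leqnn _).
have -> : 10 * q + 5 * q = 15 * q by clear; lia.
move: (\sum_(_ < 10 * q) _) (\sum_(_ < 15 * q) _) => s s'; clear.
by nia.
Qed.

(** The linear term absorbs rounding n down to a multiple of 180; the factor 2 stands for the two
    orders of the last two weights. *)
Lemma card_region_quadratic n : n ^ 2 <= 40 * (2 * #|region n| + 820 * n).
Proof.
have := region_row_sum (n %/ 180); have := @card_region_ge (n %/ 180) n.
rewrite mulnC leq_divM => /(_ isT).
have := divn_eq n 180; have := ltn_pmod n (isT : 0 < 180).
move: (n %/ 180) (n %% 180) #|_| => q r P.
move: (\sum_(_ < _) _) => s r180 -> sP sE.
by nia.
Qed.

Lemma sum_odd_minn K J : \sum_(j < J) (2 * j + 1) * (j < K) = (minn K J) ^ 2.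
Proof.
elim: J => [|J IH]; first by rewrite big_ord0 minn0.
rewrite big_ord_recr /= IH; case: (leqP K J) => KJ.
  by rewrite muln0 addn0 !(minn_idPl _) // ltnW.
by rewrite !(minn_idPr _) // 1?ltnW //; lia.
Qed.

Lemma sum_dvdn M p (F : nat -> nat) : 0 < p ->
  \sum_(1 <= n < M.+1 | p %| n) F n = \sum_(1 <= m < (M %/ p).+1) F (p * m).
Proof.
move=> p0; elim: M => [|M IH]; first by rewrite div0n !big_geq.
rewrite big_mkcond big_nat_recr //= -big_mkcond IH divnS //.
case: ifP => [pM|_]; last by rewrite addn0.
rewrite add1n [RHS]big_nat_recr //=; congr (_ + F _).
by rewrite -[LHS](divnK pM) divnS // pM mulnC.
Qed.

Definition coprime_count N n := \sum_(1 <= a < N.+1) coprime a n.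

(** An a not coprime to n is a multiple of some prime divisor of n; [N %/ p] counts the multiples of
    p. *)
Lemma coprime_count_ge N n : 0 < n ->
  N <= coprime_count N n + \sum_(1 <= p < N.+1 | prime p && (p %| n)) N %/ p.
Proof.
move=> n0.
have {1}-> : N = \sum_(1 <= a < N.+1) 1 by rewrite sum_nat_const_nat subn1 muln1.
under [X in _ + X]eq_bigr => p _ do rewrite divn_count_dvd.
rewrite exchange_big /= -big_split /= !big_nat leq_sum // => a /andP[a0 aN].
have [//|ncop] := boolP (coprime a n).
have g1 : 1 < gcdn a n.
  by rewrite ltn_neqAle eq_sym -/(coprime a n) ncop gcdn_gt0 a0.
pose p := pdiv (gcdn a n).
have pg : p %| gcdn a n := pdiv_dvd _.
have pa : p %| a := dvdn_trans pg (dvdn_gcdl _ _).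
have pn : p %| n := dvdn_trans pg (dvdn_gcdr _ _).
have pp : prime p := pdiv_prime g1.
have pN : p <= N by exact: leq_trans (dvdn_leq a0 pa) aN.
have p0 := prime_gt0 pp.
rewrite big_mkcond (bigD1_seq p) ?iota_uniq ?mem_index_iota ?p0 //=.
by rewrite pp pn pa.
Qed.

Definition sum_sq M := \sum_(1 <= n < M.+1) n ^ 2.

Lemma sum_sq_coprime_ge M N : N * sum_sq M <=
  \sum_(1 <= n < M.+1) n ^ 2 * coprime_count N n +
  \sum_(1 <= p < N.+1 | prime p) N %/ p * (p ^ 2 * sum_sq (M %/ p)).
Proof.
have -> : \sum_(1 <= p < N.+1 | prime p) N %/ p * (p ^ 2 * sum_sq (M %/ p)) =
    \sum_(1 <= n < M.+1) n ^ 2 *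
      \sum_(1 <= p < N.+1 | prime p && (p %| n)) N %/ p.
  under [RHS]eq_bigr => n _ do rewrite big_mkcondr big_distrr.
  rewrite exchange_big /=; apply: eq_bigr => p pp.
  under [RHS]eq_bigr => n _ do rewrite (fun_if (muln (n ^ 2))) muln0.
  rewrite -big_mkcond /= sum_dvdn ?prime_gt0 // /sum_sq !big_distrr /=.
  by apply: eq_bigr => m _; rewrite expnMn mulnC.
rewrite -big_split /= /sum_sq big_distrr /= !big_nat leq_sum // => n /andP[n0 _].
by rewrite -mulnDr mulnC leq_mul2l coprime_count_ge // orbT.
Qed.

(** [card_block] is used with k = min(N/n, J) periods. The cap J bounds the boundary error k^2 n by
    J^2 N for each (n, a), and leaves only J levels to sum over. *)
Lemma bad_count_block (K : fieldType) N J :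
  \sum_(1 <= n < N.+1) (minn (N %/ n) J) ^ 2 * n ^ 2 * coprime_count N n
  <= 40 * bad_count K N + 40 * 820 * J ^ 2 * N ^ 3.
Proof.
have -> : 40 * 820 * J ^ 2 * N ^ 3 =
    \sum_(1 <= n < N.+1) \sum_(1 <= a < N.+1) 40 * 820 * J ^ 2 * N.
  by rewrite !sum_nat_const_nat subn1 /=; lia.
set E := \sum_(1 <= n < N.+1) \sum_(1 <= a < N.+1) 40 * 820 * J ^ 2 * N.
apply: (@leq_trans (40 * (\sum_(1 <= n < N.+1) \sum_(1 <= a < N.+1)
    coprime a n * (2 * (minn (N %/ n) J) ^ 2 * #|region n|)) + E)); last first.
  rewrite leq_add2r leq_mul2l; apply: leq_trans (bad_count_ge K N).
  rewrite -!(big_mkord xpredT (fun n => \sum_(a < N.+1)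
    #|[set y : 'I_N.+1 * 'I_N.+1 | `[< bad K (vec4 n a y.1 y.2) >]]|)).
  rewrite [X in _ <= X]big_ltn // -[X in X <= _]add0n leq_add //.
  rewrite !big_nat leq_sum // => n /andP[n0 nN].
  rewrite -!(big_mkord xpredT (fun a =>
    #|[set y : 'I_N.+1 * 'I_N.+1 | `[< bad K (vec4 n a y.1 y.2) >]]|)).
  rewrite [X in _ <= X]big_ltn // -[X in X <= _]add0n leq_add //.
  rewrite !big_nat leq_sum // => a /andP[a0 aN].
  have [cop|_] := boolP (coprime a n); last by rewrite mul0n.
  rewrite mul1n; apply: card_block => //.
  by apply: leq_trans (leq_divM N n); rewrite leq_mul2r geq_minl orbT.
rewrite /E big_distrr -big_split /= big_nat [X in _ <= X]big_nat leq_sum // => n /andP[n0 nN].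
rewrite /coprime_count !big_distrr -big_split /= leq_sum // => a _.
case: coprime; last by rewrite muln0.
have := card_region_quadratic n.
have : (minn (N %/ n) J) ^ 2 <= J ^ 2 by rewrite leq_exp2r // geq_minr.
move: (minn _ _ ^ 2) (J ^ 2) (n ^ 2) #|_| => k J2 n2 P kJ nP.
rewrite muln1 mul1n; apply: leq_trans (leq_mul (leqnn k) nP) _.
have : k * n <= J2 * N by rewrite leq_mul.
by clear; nia.
Qed.

(** Summation by parts: a square is a sum of odd numbers 2j + 1, and j < N %/ n exactly when n <= N
    %/ (j + 1). *)
Lemma sum_minn_split N J (F : nat -> nat) :
  \sum_(1 <= n < N.+1) (minn (N %/ n) J) ^ 2 * F n =
  \sum_(j < J) (2 * j + 1) * \sum_(1 <= n < (N %/ j.+1).+1) F n.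
Proof.
under eq_big_nat => n /andP[n0 _] do rewrite -sum_odd_minn big_distrl.
rewrite exchange_big /=; apply: eq_bigr => j _.
rewrite big_distrr /= [RHS](@big_nat_widen _ _ _ 1 _ N.+1) ?ltnS ?leq_div //.
rewrite [RHS]big_mkcond /=; apply: eq_big_nat => n /andP[n0 _].
rewrite ltnS !leq_divRL // mulnC (mulnC n).
by case: leqP => _; rewrite ?muln1 ?muln0 // mulnC.
Qed.

Lemma bad_count_sum_sq (K : fieldType) N J :
  \sum_(j < J) (2 * j + 1) * (N * sum_sq (N %/ j.+1)) <=
  40 * bad_count K N + 40 * 820 * J ^ 2 * N ^ 3 +
  \sum_(j < J) (2 * j + 1) *
    \sum_(1 <= p < N.+1 | prime p) N %/ p * (p ^ 2 * sum_sq (N %/ j.+1 %/ p)).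
Proof.
set E := \sum_(j < J) (2 * j + 1) *
    \sum_(1 <= p < N.+1 | prime p) N %/ p * (p ^ 2 * sum_sq (N %/ j.+1 %/ p)).
apply: (@leq_trans (\sum_(1 <= n < N.+1)
  (minn (N %/ n) J) ^ 2 * (n ^ 2 * coprime_count N n) + E)); last first.
  rewrite leq_add2r; apply: leq_trans (bad_count_block K N J).
  by apply: leq_sum => n _; rewrite mulnA.
rewrite sum_minn_split /E -big_split leq_sum // => j _.
rewrite -[X in _ <= X + _]/(_ * _) -[X in _ <= _ + X]/(_ * _).
by rewrite -mulnDr leq_mul2l sum_sq_coprime_ge orbT.
Qed.

End UnionBound.

Lemma sum_sqE M : (6 * sum_sq M = M * M.+1 * (2 * M + 1))%N.
Proof.
rewrite /sum_sq; elim: M => [|M IH]; first by rewrite big_geq.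
by rewrite big_nat_recr //= mulnDr IH; lia.
Qed.

(** * Estimates over an ordered field *)

Section Estimates.
Variable R : realFieldType.
Implicit Types (M N P p : nat).

Lemma sum_sq_ge M : M%:R ^+ 3 / 3 <= (sum_sq M)%:R :> R.
Proof.
have : (M ^ 3 <= 3 * sum_sq M)%N by have := sum_sqE M; nia.
by rewrite -(ler_nat R) natrX natrM; lra.
Qed.

Lemma sum_sq_le M (x : R) : M%:R <= x -> (sum_sq M)%:R <= x ^+ 3 / 3 + x ^+ 2.
Proof.
move=> Mx; apply: (@le_trans _ _ (M%:R ^+ 3 / 3 + M%:R ^+ 2)).
  have : (3 * sum_sq M <= M ^ 3 + 3 * M ^ 2)%N by have := sum_sqE M; nia.
  by rewrite -(ler_nat R) natrD !natrM; lra.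
have x0 : 0 <= x := le_trans (ler0n _ _) Mx.
by apply: lerD; rewrite ?ler_pM2r ?invr_gt0 ?ltr0n // lerXn2r ?nnegrE ?ler0n.
Qed.

(* The exact value of the sum of 1/p^2 over the primes 2, 3, 5, 7, and the
   telescoping bound 1/20 for the sum over the odd numbers from 11 on. *)
Definition prime_sq_bound : R := 1 / 4 + 1 / 9 + 1 / 25 + 1 / 49 + 1 / 20.

Lemma prime_sq_sum_le N :
  \sum_(1 <= p < N.+1 | prime p) (p%:R ^+ 2)^-1 <= prime_sq_bound.
Proof.
(* Each step adds the even number 2x + 2, not prime, and perhaps 2x + 1, with 1/(2x+1)^2 <= 1/(4x) -
   1/(4(x+1)). The start x = 5 accounts for the 1/20. *)
have even_case i : \sum_(1 <= p < (2 * (i + 5)).+1 | prime p) (p%:R ^+ 2)^-1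
    <= prime_sq_bound - (4 * (i + 5)%:R)^-1 :> R.
  elim: i => [|i IH].
    rewrite /prime_sq_bound /= add0n.
    do 10 (rewrite big_ltn_cond //=); rewrite big_geq //.
    by rewrite !exprS !expr0; lra.
  have -> : (2 * (i.+1 + 5) = (2 * (i + 5)).+2)%N by lia.
  have evenN : prime (2 * (i + 5)).+2 = false.
    by apply/negbTE/negP => /even_prime[|]; [lia | rewrite /= negbK oddM].
  move: IH evenN; set y := (2 * (i + 5))%N => IH evenN.
  rewrite big_mkcond big_nat_recr // big_nat_recr //= evenN -big_mkcond.
  rewrite addr0 addSn; set x := (i + 5)%N.
  have x0 : 0 < x%:R :> R by rewrite ltr0n /x addnS.
  apply: le_trans (_ : prime_sq_bound - (4 * x%:R)^-1 +
      ((2 * x).+1%:R ^+ 2)^-1 <= _).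
    by apply: lerD IH _; case: ifP => // _; rewrite invr_ge0 exprn_ge0.
  rewrite -addrA lerD2l.
  have -> : (2 * x).+1%:R = 2 * x%:R + 1 :> R by rewrite -natr1 natrM.
  have -> : x.+1%:R = x%:R + 1 :> R by rewrite -natr1.
   have -> : - (4 * (x%:R + 1))^-1 = - (4 * x%:R)^-1 + (4 * (x%:R * (x%:R + 1)))^-1 :> R.
    by field; rewrite !gt_eqF //; lra.
  rewrite lerD2l lef_pV2 ?posrE; nra.
apply: le_trans (_ : _ <= \sum_(1 <= p < (2 * (N + 5)).+1 | prime p) (p%:R ^+ 2)^-1) _.
  rewrite [leRHS](@big_cat_nat _ _ _ N.+1) //=; last by lia.
  by rewrite lerDl sumr_ge0 // => p _; rewrite invr_ge0 exprn_ge0.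
by apply: le_trans (even_case N) _; rewrite gerBl invr_ge0 mulr_ge0.
Qed.

(** Terms with p <= P are at most 1 and the others at most e. An arbitrarily small multiple of N
    suffices, so no finer bound on the sum of 1/p is needed. *)
Lemma prime_inv_sum_le N P (e : R) : 0 <= e -> 1 <= e * P%:R ->
  \sum_(1 <= p < N.+1 | prime p) p%:R^-1 <= P%:R + e * N%:R :> R.
Proof.
move=> e0 eP.
have le_term p : (0 < p)%N -> p%:R^-1 <= (p <= P)%:R + e :> R.
  move=> p0; have [pP|Pp] := leqP p P.
    apply: (@le_trans _ _ 1); last by rewrite lerDl.
    by rewrite invf_le1 ?ltr0n // ler1n.
  rewrite add0r -div1r ler_pdivrMr ?ltr0n //; apply: le_trans eP _.
  by rewrite ler_wpM2l // ler_nat ltnW.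
apply: (@le_trans _ _ (\sum_(1 <= p < N.+1) ((p <= P)%:R + e))).
  rewrite big_mkcond !big_nat ler_sum // => p /andP[p0 _].
  by case: ifP => _; [exact: le_term | rewrite addr_ge0 ?ler0n].
rewrite big_split /= sumr_const_nat subn1 /= mulr_natr lerD2r -natr_sum ler_nat.
elim: N => [|N IH]; first by rewrite big_geq.
rewrite big_nat_recr //=; case: (leqP N.+1 P) => NP; last by rewrite addn0.
rewrite addn1; apply: leq_trans NP; rewrite ltnS.
apply: (@leq_trans (\sum_(1 <= p < N.+1) 1)%N).
  by apply: leq_sum => p _; case: (p <= P)%N.
by rewrite sum_nat_const_nat subn1 muln1.
Qed.

Lemma divn_le_div n d : (0 < d)%N -> (n %/ d)%:R <= n%:R / d%:R :> R.
Proof.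
by move=> d0; rewrite ler_pdivlMr ?ltr0n // -natrM ler_nat leq_divM.
Qed.

Lemma sieve_error_le M N P (e : R) : (M <= N)%N -> 0 <= e -> 1 <= e * P%:R ->
  (\sum_(1 <= p < N.+1 | prime p) N %/ p * (p ^ 2 * sum_sq (M %/ p)))%:R <=
  N%:R * M%:R ^+ 3 / 3 * prime_sq_bound + N%:R ^+ 3 * (P%:R + e * N%:R) :> R.
Proof.
move=> MN e0 eP; rewrite natr_sum.
apply: (@le_trans _ _ (\sum_(1 <= p < N.+1 | prime p)
    (N%:R * M%:R ^+ 3 / 3 * (p%:R ^+ 2)^-1 + N%:R * M%:R ^+ 2 * p%:R^-1))).
  apply: ler_sum => p /prime_gt0 p0.
  have q0 : 0 < p%:R :> R by rewrite ltr0n.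
  rewrite natrM [(p ^ 2 * _)%:R]natrM natrX.
  apply: (@le_trans _ _ ((N%:R / p%:R) *
      (p%:R ^+ 2 * ((M%:R / p%:R) ^+ 3 / 3 + (M%:R / p%:R) ^+ 2)))).
    apply: ler_pM; rewrite ?divn_le_div ?mulr_ge0 ?ler0n // ?exprn_ge0 //.
    by rewrite ler_wpM2l ?exprn_ge0 // sum_sq_le // divn_le_div.
  by rewrite le_eqVlt; apply/orP; left; apply/eqP; field; rewrite gt_eqF.
rewrite big_split -!mulr_sumr /=; apply: lerD.
  by rewrite ler_wpM2l ?prime_sq_sum_le // !mulr_ge0 ?exprn_ge0 // invr_ge0.
have NM : N%:R * M%:R ^+ 2 <= N%:R ^+ 3 :> R.
  by rewrite [X in _ <= X]exprS ler_wpM2l // lerXn2r ?nnegrE // ler_nat.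
apply: ler_pM (prime_inv_sum_le _ e0 eP) => //; first by rewrite mulr_ge0 ?exprn_ge0 ?ler0n.
by rewrite sumr_ge0 // => p _; rewrite invr_ge0 ler0n.
Qed.

Lemma main_term_ge M N P (e : R) j : M = (N %/ j.+1)%N -> 0 <= e -> 1 <= e * P%:R ->
  (1 - prime_sq_bound) / 3 * (N%:R ^+ 4 / j.+1%:R ^+ 3 - 3 * N%:R ^+ 3)
    - N%:R ^+ 3 * (P%:R + e * N%:R) <=
  (N * sum_sq M)%:R -
  (\sum_(1 <= p < N.+1 | prime p) N %/ p * (p ^ 2 * sum_sq (M %/ p)))%:R :> R.
Proof.
move=> ME e0 eP; have MN : (M <= N)%N by rewrite ME leq_div.
have := sieve_error_le MN e0 eP; set E := (\sum_(_ <= _ < _ | _) _)%:R => E_le.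
have SM := sum_sq_ge M.
have NSM : N%:R * (M%:R ^+ 3 / 3) <= (N * sum_sq M)%:R :> R.
  by rewrite natrM ler_wpM2l.
have M3 : N%:R ^+ 3 / j.+1%:R ^+ 3 - 3 * N%:R ^+ 2 <= M%:R ^+ 3 :> R.
  have j0 : 0 < j.+1%:R :> R by rewrite ltr0n.
  have : N%:R / j.+1%:R <= M%:R + 1 :> R.
    rewrite ler_pdivrMr // natr1 -natrM ler_nat ME.
    by have := ltn_ceil N (ltn0Sn j); exact: ltnW.
  have : N%:R / j.+1%:R <= N%:R :> R by rewrite ler_pdivrMr // ler_peMr // ler1n.
  have : 0 <= N%:R / j.+1%:R :> R by rewrite divr_ge0.
  have : 0 <= M%:R :> R by [].
  rewrite -expr_div_n; move: (M%:R) (N%:R) (N%:R / _) => m n x m0 x0 xn xm.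
  have xn2 : x ^+ 2 <= n ^+ 2 by rewrite lerXn2r ?nnegrE // (le_trans x0).
  (* For x >= 1 the cube of m >= x - 1 loses at most 3 x^2; for x < 1 already x^3 <= x^2. *)
  have [x1|/ltW x1] := lerP 1 x; last first.
    have : x ^+ 3 <= x ^+ 2 by rewrite ler_wiXn2l.
    have : 0 <= m ^+ 3 by rewrite exprn_ge0.
    have : 0 <= x ^+ 2 by rewrite exprn_ge0.
    lra.
  have : (x - 1) ^+ 3 <= m ^+ 3 by rewrite lerXn2r ?nnegrE //; lra.
  lra.
have : N%:R * (N%:R ^+ 3 / j.+1%:R ^+ 3 - 3 * N%:R ^+ 2) <= N%:R * M%:R ^+ 3 :> R.
  by rewrite ler_wpM2l.
have -> : N%:R * (N%:R ^+ 3 / j.+1%:R ^+ 3 - 3 * N%:R ^+ 2) =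
  N%:R ^+ 4 / j.+1%:R ^+ 3 - 3 * N%:R ^+ 3 :> R by ring.
move: NSM E_le; rewrite /prime_sq_bound.
move: (N%:R ^+ 4 / _) (N%:R ^+ 3 * _) => X Y.
lra.
Qed.

End Estimates.

Lemma exists_nat_ge (R : archiRealFieldType) (x : R) : exists n : nat, x <= n%:R.
Proof.
have [x0|/ltW x0] := lerP 0 x; last by exists 0%N.
exists (Num.bound x); exact: ltW (archi_boundP x0).
Qed.

Lemma bad_count_ge_fourth_field (R : archiRealFieldType) (K : fieldType) :
  exists N0 : nat, forall N : nat, (N0 <= N)%N ->
  N%:R ^+ 4 <= 120 * (bad_count K N)%:R :> R.
Proof.
(* (1 - prime_sq_bound) / 3 times the sum of (2j + 1) / (j + 1)^3 over j < 12 is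
   about 0.3402 > 1/3; the error 12^2 e with e = 1/90000 fits in between. *)
have [P0 P0E] := exists_nat_ge (300 * 300 : R).
have [P [e [e0 eP eE]]] : exists (P : nat) (e : R),
    [/\ 0 <= e, 1 <= e * P%:R & e * (300 * 300) = 1].
  have c0 : 0 < 300 * 300 :> R by rewrite mulr_gt0 ?ltr0n.
  exists P0, (300 * 300)^-1; split; first by rewrite invr_ge0 ltW.
    by rewrite mulrC ler_pdivlMr ?mul1r.
  by rewrite mulVf // gt_eqF.
(* From this [N0] on, all the terms in N^3 together are at most N^4/1000; 144 is the sum of 2j + 1
   over j < 12. *)
have [N0 N0E] := exists_nat_ge ((40 * 820 * 144 + 144 + 144 * P%:R) * 1000 : R).
exists N0 => N N0N.
have CN : (40 * 820 * 144 + 144 + 144 * P%:R) * 1000 <= N%:R :> R.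
  by apply: le_trans N0E _; rewrite ler_nat.
have H : \sum_(0 <= j < 12) (2 * j%:R + 1) *
    ((1 - prime_sq_bound R) / 3 * (N%:R ^+ 4 / j.+1%:R ^+ 3 - 3 * N%:R ^+ 3)
    - N%:R ^+ 3 * (P%:R + e * N%:R)) <=
    40 * (bad_count K N)%:R + 40 * 820 * 144 * N%:R ^+ 3.
  have := bad_count_sum_sq K N 12; rewrite -(ler_nat R) => H.
  have {H} : \sum_(j < 12) (2 * j + 1)%:R * ((N * sum_sq (N %/ j.+1))%:R -
    (\sum_(1 <= p < N.+1 | prime p)
       N %/ p * (p ^ 2 * sum_sq (N %/ j.+1 %/ p)))%:R) <=
    40 * (bad_count K N)%:R + 40 * 820 * 144 * N%:R ^+ 3 :> R.
    under eq_bigr => j _ do rewrite mulrBr -!natrM.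
    rewrite big_split sumrN -!natr_sum lerBlDr; apply: le_trans H _.
    rewrite natrD lerD2r natrD natrM lerD2l.
    by rewrite [X in X <= _]natrM natrX !natrM; lra.
  apply: le_trans; rewrite big_mkord; apply: ler_sum => j _.
  rewrite natrD natrM ler_wpM2l ?addr_ge0 ?mulr_ge0 ?ler0n //.
  exact: main_term_ge e0 eP.
have CN4 : (40 * 820 * 144 + 144 + 144 * P%:R) * 1000 * N%:R ^+ 3 <= N%:R ^+ 4 :> R.
  by rewrite [X in _ <= X]exprS ler_wpM2r ?exprn_ge0.
have y0 : 0 <= N%:R ^+ 4 :> R by rewrite exprn_ge0.
have z0 : 0 <= N%:R ^+ 3 :> R by rewrite exprn_ge0.
have x0 : 0 <= N%:R ^+ 3 * P%:R :> R by rewrite mulr_ge0 // exprn_ge0.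
have xE : N%:R ^+ 3 * (P%:R + e * N%:R) = N%:R ^+ 3 * P%:R + e * N%:R ^+ 4 :> R by ring.
have CE : (40 * 820 * 144 + 144 + 144 * P%:R) * 1000 * N%:R ^+ 3 =
 (40 * 820 * 144 + 144) * 1000 * N%:R ^+ 3 + 144 * 1000 * (N%:R ^+ 3 * P%:R) :> R by ring.
have {}eE : e * N%:R ^+ 4 * (300 * 300) = N%:R ^+ 4 by rewrite mulrAC eE mul1r.
move: H CN4 y0 z0 x0 eE; rewrite CE xE.
do 12 (rewrite big_ltn //); rewrite big_geq // /prime_sq_bound.
move: (bad_count K N)%:R (N%:R ^+ 3) (N%:R ^+ 4) (N%:R ^+ 3 * P%:R) (e * N%:R ^+ 4).
clear => b z y x w H CN4 y0 z0 x0 eE.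
lra.
Qed.

Lemma bad_count_ge_fourth (K : fieldType) :
  exists N0 : nat, forall N : nat, (N0 <= N)%N -> (N ^ 4 <= 120 * bad_count K N)%N.
Proof.
have [N0 H] := bad_count_ge_fourth_field rat K.
by exists N0 => N /H; rewrite -natrX -natrM ler_nat.
Qed.

(* The bound on pi and the lower limit *)
From mathcomp Require Import reals ereal topology normedtype sequences trigo.
From mathcomp Require Import derive realfun.
Import numFieldNormedType.Exports.

Lemma sin_le_id (R : realType) (x : R) : 0 <= x -> sin x <= x.
Proof.
move=> x0; have [|c _] := MVT_segment x0 (fun y _ => is_derive_sin y).
  apply: (@continuous_subspaceT _ _ _ sin); exact: continuous_sin.
rewrite sin0 !subr0 => ->; by rewrite ler_piMl ?cos_le1.
Qed.

(** If pi < 3, then sin(pi/16) < 3/16, and three doublings of the cosine starting from 1 - 2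
    (3/16)^2 = 119/128 make cos(pi/2) positive. *)
Lemma pi_ge3 (R : realType) : 3 <= pi :> R.
Proof.
rewrite leNgt; apply/negP => pi3.
have p0 := pi_gt0 R.
pose x : R := pi / 16.
have sx : sin x <= x by rewrite sin_le_id // divr_ge0 // ltW.
have sx0 : 0 <= sin x.
  by rewrite sin_ge0_pi // /x; apply/andP; split; lra.
have s2 : sin x ^+ 2 <= x ^+ 2 by rewrite lerXn2r ?nnegrE // divr_ge0 // ltW.
have x2 : x ^+ 2 <= (3 / 16) ^+ 2.
  by rewrite lerXn2r ?nnegrE ?divr_ge0 // ?ltW // /x; lra.
have c8 : 119 / 128 <= cos (x *+ 2).
  by rewrite cos_mulr2n; have := cos2Dsin2 x; lra.
have c4 : 93 / 128 <= cos (x *+ 2 *+ 2).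
  rewrite cos_mulr2n; have : (119 / 128) ^+ 2 <= cos (x *+ 2) ^+ 2.
    by rewrite lerXn2r ?nnegrE //; lra.
  by lra.
have : 0 < cos (x *+ 2 *+ 2 *+ 2).
  rewrite cos_mulr2n; have : (93 / 128) ^+ 2 <= cos (x *+ 2 *+ 2) ^+ 2.
    by rewrite lerXn2r ?nnegrE //; lra.
  by lra.
have -> : x *+ 2 *+ 2 *+ 2 = pi / 2 by rewrite /x; lra.
by rewrite cos_pihalf ltxx.
Qed.

Lemma limn_einf_ge (R : realType) (u : nat -> \bar R) (c : \bar R) (N0 : nat) :
  (forall n, (N0 <= n)%N -> (c <= u n)%E) -> (c <= limn_einf u)%E.
Proof.
move=> cu; rewrite limn_einf_lim; apply: lime_ge; first exact: is_cvg_einfs.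
exists N0 => // n /= N0n; apply/ereal_infP => _ [m /= nm <-].
exact/cu/(leq_trans N0n).
Qed.

Theorem theorem3 (R : realType) (K : fieldType) :
  ((3 / (40 * pi ^+ 2) : R)%:E <=
   limn_einf (fun N : nat => ((bad_count K N)%:R / N%:R ^+ 4 : R)%:E))%E.
Proof.
have [N0 N0P] := bad_count_ge_fourth K.
apply: (@limn_einf_ge _ _ _ N0.+1) => N N0N; rewrite lee_fin.
have N_gt0 : 0 < N%:R :> R by rewrite ltr0n (leq_trans _ N0N).
apply: (@le_trans _ _ (1 / 120)).
  (* The inequality 3/(40 pi^2) <= 1/120 amounts to pi^2 >= 9. *)
  have pi9 : 3 ^+ 2 <= pi ^+ 2 :> R by rewrite lerXn2r ?nnegrE ?pi_ge0 ?pi_ge3.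
  by rewrite ler_pdivrMr; lra.
rewrite ler_pdivlMr ?exprn_gt0 //.
have := N0P N (ltnW N0N); rewrite -(ler_nat R) natrX natrM.
lra.
Qed.
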